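(* Suppose $K$ is one component of a link of unit thickness in $\mathbb{R}^3$, and the other components can be partitioned into $n$ sublinks, each of which is topologically linked to $K$. Then the length of $K$ is at least $2\pi+P_n$, where $P_n$ is the minimum length of any curve in the plane surrounding $n$ disjoint unit disks.
   Context: A link is a disjoint union of finitely many simple closed curves in $\mathbb{R}^3$. For distinct $x,y,z$, $r(x,y,z)$ is the radius of the circle through them ($\infty$ if collinear); the thickness of a link $L$ is $\inf r(x,y,z)$ over pairwise distinct $x,y,z\in L$. Unit thickness means thickness equal to $1$. A sublink is topologically linked to $K$ if it cannot be separated from $K$ (in particular it must meet every disk spanning $K$). *)

(* Defs.v *)
From HB Require Import structures.
From mathcomp Require Import all_boot all_order all_algebra.
From mathcomp Require Import all_classical all_reals all_analysis.
Set Implicit Arguments. Unset Strict Implicit. Unset Printing Implicit Defensive.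
Import Order.TTheory GRing.Theory Num.Theory.
Import numFieldNormedType.Exports.
Local Open Scope classical_set_scope.
Local Open Scope ring_scope.

Section Defs.
Variable R : realType.

Definition edist (d : nat) (x y : 'rV[R]_d) : R :=
  Num.sqrt (\sum_(i < d) (x ord0 i - y ord0 i) ^+ 2).

Definition dotp (d : nat) (x y : 'rV[R]_d) : R :=
  \sum_(i < d) x ord0 i * y ord0 i.

(* r(x,y,z): radius of the circle through x, y, z; +oo if none exists
   (i.e. if they are collinear).  A circle through x,y,z has its center c
   in the plane of x,y,z and equidistant from the three points. *)
Definition circumradius (x y z : 'rV[R]_3) : \bar R :=
  ereal_inf [set (edist c x)%:E | c in
    [set c : 'rV[R]_3 |
       (exists s t : R, c = x + s *: (y - x) + t *: (z - x)) /\
       edist c x = edist c y /\ edist c x = edist c z]].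

Definition thickness (L : set 'rV[R]_3) : \bar R :=
  ereal_inf [set r | exists x y z, [/\ L x, L y, L z,
     [/\ x <> y, y <> z & x <> z] & r = circumradius x y z]].

Definition closed_curve (d : nat) (g : R -> 'rV[R]_d) : Prop :=
  continuous g /\ (forall t, g (t + 1) = g t).

Definition simple_closed_curve (d : nat) (g : R -> 'rV[R]_d) : Prop :=
  closed_curve g /\ {in `[0, 1[%classic &, injective g}.

Definition curve_length (d : nat) (g : R -> 'rV[R]_d) : \bar R :=
  ereal_sup [set l | exists (k : nat) (t : nat -> R),
     [/\ t 0%N = 0, t k = 1, (forall i, (i < k)%N -> t i <= t i.+1) &
       l = (\sum_(i < k) edist (g (t i.+1)) (g (t i)))%:E]].

Definition is_link (m : nat) (g : 'I_m -> R -> 'rV[R]_3) : Prop :=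
  (forall i, simple_closed_curve (g i)) /\
  (forall i j, i != j -> [disjoint range (g i) & range (g j)]).

Definition link_set (m : nat) (g : 'I_m -> R -> 'rV[R]_3) : set 'rV[R]_3 :=
  \bigcup_(i in [set: 'I_m]) range (g i).

(* ambient isotopy of R^3 (time parameter in [0,1]; w.l.o.g. extended
   continuously to all of R) *)
Definition ambient_isotopy (H : R -> 'rV[R]_3 -> 'rV[R]_3) : Prop :=
  continuous (fun p : R * 'rV[R]_3 => H p.1 p.2) /\
  H 0 = id /\
  (forall t, 0 <= t <= 1 ->
     exists Hi : 'rV[R]_3 -> 'rV[R]_3,
       cancel (H t) Hi /\ cancel Hi (H t) /\ continuous (H t) /\ continuous Hi).

Definition separable (A B : set 'rV[R]_3) : Prop :=
  exists H, ambient_isotopy H /\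
    exists (v : 'rV[R]_3) (c : R),
      (forall x, A x -> dotp v (H 1 x) < c) /\
      (forall x, B x -> c < dotp v (H 1 x)).

Definition topologically_linked (L K : set 'rV[R]_3) : Prop :=
  ~ separable L K.

Definition sublink (m n : nat) (g : 'I_m -> R -> 'rV[R]_3) (k : 'I_m)
  (f : 'I_m -> 'I_n) (j : 'I_n) : set 'rV[R]_3 :=
  \bigcup_(i in [set i : 'I_m | i != k /\ f i = j]) range (g i).

Definition surrounds_disk (g : R -> 'rV[R]_2) (c : 'rV[R]_2) : Prop :=
  forall p, edist p c <= 1 -> ~ range g p ->
    exists M : R, forall q,
      connected_component (~` range g) p q -> edist q 0 <= M.

(* P_n: infimum (the paper's minimum) of lengths of planar closed curves
   surrounding n pairwise disjoint closed unit disks. *)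
Definition Pn (n : nat) : \bar R :=
  ereal_inf [set l | exists g : R -> 'rV[R]_2,
     [/\ closed_curve g,
      exists c : 'I_n -> 'rV[R]_2,
        (forall i j, i != j -> 2 < edist (c i) (c j)) /\
        (forall i, surrounds_disk g (c i)) &
      l = curve_length g]].

End Defs.

(* Main.v *)
(**
  Let [K] be the component [g k], of finite length. A fine inscribed polygon of
  [K] has a cone point [p] at which its angles add up to exactly [2 * pi]: the sum
  is at least [2 * pi] at a point of an edge, tends to 0 at infinity and is
  continuous in between. The cone from [p] therefore develops onto the plane, and
  by the spherical triangle inequality the development does not decrease
  distances. A sublink that missed the cone over [K] could be separated from [K]
  by shrinking the cone to [p] and sliding it away along a line missing the
  sublink; so each sublink meets the cone. The [n] developed meeting points are at
  mutual distance about 2 and at distance about 2 from the developed polygon [W],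
  which winds around them: the support function of [W] exceeds that of the points
  by about 2 in every direction. Comparing, in finitely many equally spaced
  directions, a discrete Crofton formula for the length of [W] with the perimeter
  of a polygon circumscribed about the unit disks around the points yields
  [2 * pi + Pn] up to errors that vanish in the limit.
*)
Require Import Defs.
From HB Require Import structures.
From mathcomp Require Import all_boot all_order all_algebra.
From mathcomp Require Import all_classical all_reals all_analysis.
From mathcomp Require Import ring lra zify.
Import Order.TTheory GRing.Theory Num.Theory.
Import numFieldNormedType.Exports.
Local Open Scope classical_set_scope.
Local Open Scope ring_scope.
Set Implicit Arguments.
Unset Strict Implicit.
Unset Printing Implicit Defensive.
(* [edist] also names the extended distance of MathComp-Analysis. *)
Import Defs.

(** * Euclidean vectors *)

(** The curves are merely continuous, so neither tangents nor normal tubes nor general position are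
    at hand. All metric information is drawn from triples of points: a circumradius of at least 1
    forces a triangle with sides at most 1 to be nearly straight. This yields the distance 2 between
    components, where two points of a curve on either side of a nearest point replace its tangent.
    It also shows that a bounded thick set has only O(1/e) points at mutual distances at least e,
    which provides the line that misses a sublink.

    A sublink meets the cone over [K] itself, while only the polygonal cone is developed, with
    distances compared on its spokes. Meeting points are therefore moved to a nearby spoke, at a
    cost controlled by the mesh.

    Finitely many directions replace the integral of Crofton's formula. With angular step [a] and
    support values [H], a closed polygon has length at least [2 sin (a / 2)] times the sum of [H],
    and the circumscribed polygon has perimeter exactly [2 tan (a / 2)] times that sum. The ratio
    [cos (a / 2)] is the whole loss of discretisation in comparing the two. *)

Section EuclideanVectors.
Variables (R : realType) (d : nat).
Implicit Types (x y z u v w : 'rV[R]_d) (a b : R).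

Lemma dotpC u v : dotp u v = dotp v u.
Proof. by apply: eq_bigr => i _; rewrite mulrC. Qed.

Lemma dotpDl u v w : dotp (u + v) w = dotp u w + dotp v w.
Proof. by rewrite -big_split; apply: eq_bigr => i _; rewrite mxE mulrDl. Qed.

Lemma dotpZl a u w : dotp (a *: u) w = a * dotp u w.
Proof. by rewrite /dotp mulr_sumr; apply: eq_bigr => i _; rewrite mxE mulrA. Qed.

Lemma dotpDr w u v : dotp w (u + v) = dotp w u + dotp w v.
Proof. by rewrite ![dotp w _]dotpC dotpDl. Qed.

Lemma dotpZr a w u : dotp w (a *: u) = a * dotp w u.
Proof. by rewrite ![dotp w _]dotpC dotpZl. Qed.

Lemma dotpNl u w : dotp (- u) w = - dotp u w.
Proof. by rewrite -scaleN1r dotpZl mulN1r. Qed.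

Lemma dotpNr w u : dotp w (- u) = - dotp w u.
Proof. by rewrite -scaleN1r dotpZr mulN1r. Qed.

Lemma dotp0l w : dotp 0 w = 0.
Proof. by rewrite -(scale0r 0) dotpZl mul0r. Qed.

Lemma dotp0r w : dotp w 0 = 0.
Proof. by rewrite dotpC dotp0l. Qed.

Definition dotpE := (dotpDl, dotpDr, dotpNl, dotpNr, dotpZl, dotpZr, dotp0l, dotp0r).

Lemma dotpBB u v : dotp (u - v) (u - v) = dotp u u + dotp v v - 2 * dotp u v.
Proof. by rewrite !dotpE [dotp v u]dotpC; ring. Qed.

Lemma dotp_ge0 u : 0 <= dotp u u.
Proof. by apply: sumr_ge0 => i _; rewrite -expr2 sqr_ge0. Qed.

Lemma dotp_eq0 u : (dotp u u == 0) = (u == 0).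
Proof.
apply/eqP/eqP => [|->]; last exact: dotp0l.
move=> /(psumr_eq0P (fun i _ => _)) H; apply/rowP => i; rewrite mxE.
have /eqP : u ord0 i * u ord0 i = 0.
  by apply: H => // j; rewrite -expr2 sqr_ge0.
by rewrite mulf_eq0 orbb => /eqP.
Qed.

Lemma dotp_gt0 u : (0 < dotp u u) = (u != 0).
Proof. by rewrite lt_def dotp_ge0 andbT dotp_eq0. Qed.

Definition vnorm u : R := Num.sqrt (dotp u u).

Lemma vnorm_ge0 u : 0 <= vnorm u. Proof. exact: sqrtr_ge0. Qed.

Lemma sqr_vnorm u : vnorm u ^+ 2 = dotp u u.
Proof. by rewrite sqr_sqrtr// dotp_ge0. Qed.

Lemma vnorm_eq0 u : (vnorm u == 0) = (u == 0).
Proof. by rewrite -sqrf_eq0 sqr_vnorm dotp_eq0. Qed.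

Lemma vnorm_gt0 u : (0 < vnorm u) = (u != 0).
Proof. by rewrite lt_def vnorm_ge0 andbT vnorm_eq0. Qed.

Lemma vnorm0 : vnorm 0 = 0.
Proof. by apply/eqP; rewrite vnorm_eq0. Qed.

Lemma vnormN u : vnorm (- u) = vnorm u.
Proof. by rewrite /vnorm dotpNl dotpNr opprK. Qed.

Lemma vnormZ a u : vnorm (a *: u) = `|a| * vnorm u.
Proof.
by rewrite /vnorm dotpZl dotpZr mulrA -expr2 sqrtrM ?sqr_ge0// sqrtr_sqr.
Qed.

Lemma vnormB u v : vnorm (u - v) = vnorm (v - u).
Proof. by rewrite -vnormN opprB. Qed.

Lemma cauchy_schwarz_sqr u v : dotp u v ^+ 2 <= dotp u u * dotp v v.
Proof.
have [->|v0] := eqVneq v 0; first by rewrite !dotpE expr2 !mulr0.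
have v_gt0 : 0 < dotp v v by rewrite dotp_gt0.
have := dotp_ge0 (dotp v v *: u - dotp u v *: v).
rewrite !dotpE [dotp v u]dotpC.
set a := dotp u u; set b := dotp u v; set c := dotp v v => H.
have : 0 <= c * (a * c - b ^+ 2) by nra.
by rewrite pmulr_rge0// subr_ge0.
Qed.

Lemma cauchy_schwarz_abs u v : `|dotp u v| <= vnorm u * vnorm v.
Proof.
rewrite -sqrtr_sqr -sqrtrM ?dotp_ge0// ler_sqrt ?mulr_ge0 ?dotp_ge0//.
exact: cauchy_schwarz_sqr.
Qed.

Lemma cauchy_schwarz u v : dotp u v <= vnorm u * vnorm v.
Proof. exact: le_trans (ler_norm _) (cauchy_schwarz_abs _ _). Qed.

Lemma vnormD u v : vnorm (u + v) <= vnorm u + vnorm v.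
Proof.
rewrite -(@ler_pXn2r _ 2)// ?nnegrE ?addr_ge0 ?vnorm_ge0//.
rewrite sqr_vnorm !dotpE [dotp v u]dotpC sqrrD !sqr_vnorm.
by have := cauchy_schwarz u v; lra.
Qed.

Lemma vnorm_sum (I : Type) (r : seq I) (P : pred I) (F : I -> 'rV[R]_d) :
  vnorm (\sum_(i <- r | P i) F i) <= \sum_(i <- r | P i) vnorm (F i).
Proof.
elim/big_ind2 : _ => [|u a v b ua vb|//]; first by rewrite vnorm0.
by apply: le_trans (vnormD _ _) _; exact: lerD.
Qed.

Lemma edistE x y : edist x y = vnorm (x - y).
Proof. by congr Num.sqrt; apply: eq_bigr => i _; rewrite !mxE expr2. Qed.

Lemma edist_ge0 x y : 0 <= edist x y.
Proof. by rewrite edistE vnorm_ge0. Qed.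

Lemma edistC x y : edist x y = edist y x.
Proof. by rewrite !edistE vnormB. Qed.

Lemma edist_xx x : edist x x = 0.
Proof. by rewrite edistE subrr vnorm0. Qed.

Lemma edist_gt0 x y : (0 < edist x y) = (x != y).
Proof. by rewrite edistE vnorm_gt0 subr_eq0. Qed.

Lemma edist_triangle x y z : edist x z <= edist x y + edist y z.
Proof.
rewrite !edistE (_ : x - z = (x - y) + (y - z)) ?vnormD//.
by rewrite addrA subrK.
Qed.

Lemma sqr_edist x y : edist x y ^+ 2 = dotp (x - y) (x - y).
Proof. by rewrite edistE sqr_vnorm. Qed.

Lemma coord_le_vnorm u i : `|u ord0 i| <= vnorm u.
Proof.
rewrite -sqrtr_sqr ler_sqrt ?dotp_ge0// /dotp (bigD1 i)//= -expr2 lerDl.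
by apply: sumr_ge0 => j _; rewrite -expr2 sqr_ge0.
Qed.

Lemma vnorm_le_sum u : vnorm u <= \sum_i `|u ord0 i|.
Proof.
have S0 : 0 <= \sum_i `|u ord0 i| by exact: sumr_ge0.
rewrite -(@ler_pXn2r _ 2)// ?nnegrE ?vnorm_ge0//.
rewrite sqr_vnorm expr2 mulr_suml; apply: ler_sum => i _.
rewrite -[u _ _ * _]expr2 -real_normK ?num_real// expr2 ler_wpM2l//.
by rewrite (bigD1 i)//= lerDl sumr_ge0.
Qed.

End EuclideanVectors.

Section EuclideanTopology.
Variables (R : realType).

Section Combinators.
Variables (T : topologicalType) (W : normedModType R).

Lemma cont_comp (U Z : topologicalType) (f : T -> U) (g : U -> Z) :
  continuous f -> continuous g -> continuous (fun x => g (f x)).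
Proof. by move=> cf cg x; exact: (@continuous_comp _ _ _ f g x (cf x) (cg _)). Qed.

Lemma cont_id : continuous (fun x : T => x).
Proof. by move=> x; exact: cvg_id. Qed.

Lemma cont_cst (U : topologicalType) (c : U) : continuous (fun _ : T => c).
Proof. exact: cst_continuous. Qed.

Lemma contD (f g : T -> W) :
  continuous f -> continuous g -> continuous (fun x => f x + g x).
Proof. by move=> cf cg x; exact: (@continuousD _ _ _ f g x (cf x) (cg x)). Qed.

Lemma contB (f g : T -> W) :
  continuous f -> continuous g -> continuous (fun x => f x - g x).
Proof. by move=> cf cg x; exact: (@continuousB _ _ _ f g x (cf x) (cg x)). Qed.

Lemma contZ (f : T -> R) (g : T -> W) :
  continuous f -> continuous g -> continuous (fun x => f x *: g x).
Proof. by move=> cf cg x; exact: (cvgZ (cf x) (cg x)). Qed.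

Lemma contM (f g : T -> R) :
  continuous f -> continuous g -> continuous (fun x => f x * g x).
Proof. by move=> cf cg x; exact: (@continuousM _ _ f g x (cf x) (cg x)). Qed.

Lemma cont_max (f g : T -> R) :
  continuous f -> continuous g -> continuous (fun x => Num.max (f x) (g x)).
Proof. by move=> cf cg x; exact: (@continuous_max _ _ f g x (cf x) (cg x)). Qed.

Lemma cont_min (f g : T -> R) :
  continuous f -> continuous g -> continuous (fun x => Num.min (f x) (g x)).
Proof. by move=> cf cg x; exact: (@continuous_min _ _ f g x (cf x) (cg x)). Qed.

Lemma cont_norm (f : T -> R) :
  continuous f -> continuous (fun x => `|f x|).
Proof. by move=> cf; apply: cont_comp cf _; exact: norm_continuous. Qed.

End Combinators.

Lemma continuous_rV (T : topologicalType) d (f : T -> 'rV[R]_d) :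
  (forall i, continuous (fun x => f x ord0 i)) -> continuous f.
Proof.
move=> cf x A [P xP PA]; apply: filterS PA _; rewrite /nbhs/= /fmap/=.
have : \forall y \near x, forall i, P ord0 i (f y ord0 i).
  by apply: filter_forall => i; exact: (cf i x _ (xP ord0 i)).
by apply: filterS => y yP i j; rewrite ord1.
Qed.

Lemma continuous_coord (T : topologicalType) d (f : T -> 'rV[R]_d) i :
  continuous f -> continuous (fun x => f x ord0 i).
Proof.
move=> cf x; exact: (@continuous_comp _ _ _ f (fun M : 'rV[R]_d => M ord0 i) x
  (cf x) (@coord_continuous _ _ _ _ _ _)).
Qed.

Lemma continuous_sumr (T : topologicalType) (I : Type) (r : seq I)
    (P : pred I) (F : I -> T -> R) :
  (forall i, continuous (F i)) ->
  continuous (fun x => \sum_(i <- r | P i) F i x).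
Proof.
move=> cF; elim: r => [|i r IH].
  by under eq_fun do rewrite big_nil; move=> x; exact: cvg_cst.
under eq_fun do rewrite big_cons; case: (P i) => // x.
by apply: continuousD; [exact: cF|exact: IH].
Qed.

Lemma continuous_dotp (T : topologicalType) d (f g : T -> 'rV[R]_d) :
  continuous f -> continuous g -> continuous (fun x => dotp (f x) (g x)).
Proof.
move=> cf cg; apply: continuous_sumr => i x.
by apply: continuousM; exact: continuous_coord.
Qed.

Lemma continuous_vnorm (T : topologicalType) d (f : T -> 'rV[R]_d) :
  continuous f -> continuous (fun x => vnorm (f x)).
Proof.
move=> cf x; apply: (@continuous_comp _ _ _ (fun x => dotp (f x) (f x)) Num.sqrt).
  exact: continuous_dotp.
exact: sqrt_continuous.
Qed.

Lemma continuous_edist (T : topologicalType) d (f g : T -> 'rV[R]_d) :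
  continuous f -> continuous g -> continuous (fun x => edist (f x) (g x)).
Proof.
move=> cf cg; under eq_fun do rewrite edistE.
by apply: continuous_vnorm => x; apply: continuousB; [exact: cf|exact: cg].
Qed.

Lemma lipschitz_continuous_rV d (f : 'rV[R]_d -> R) (C : R) :
  (forall x y, `|f x - f y| <= C * edist x y) -> continuous f.
Proof.
move=> lf x; apply/(@cvgrPdist_le R R 'rV[R]_d (nbhs x) _ f (f x)) => e e0.
have C1 : 0 < `|C| + 1 by rewrite ltr_pwDr.
have : \forall y \near x, edist x y <= e / (`|C| + 1).
  have cd : continuous (fun y : 'rV[R]_d => edist x y).
    apply: (@continuous_edist 'rV[R]_d d (fun=> x) (fun y => y)).
      exact: cst_continuous.
    by move=> y; exact: cvg_id.
  move/(@cvgrPdist_le R R 'rV[R]_d (nbhs x) _): (cd x).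
  move=> /(_ _ (divr_gt0 e0 C1)).
  by apply: filterS => y; rewrite edist_xx sub0r normrN ger0_norm ?edist_ge0.
apply: filterS => y; rewrite ler_pdivlMr// => H.
apply: le_trans (lf x y) _; apply: le_trans H; rewrite mulrC.
by rewrite ler_wpM2l ?edist_ge0// (le_trans (ler_norm C))// lerDl.
Qed.

End EuclideanTopology.

(** * Thickness and distances between components *)

Section Thickness.
Variable R : realType.
Implicit Types (L S : set 'rV[R]_3) (x y z u v w : 'rV[R]_3).

(* [4 (|u|^2 |v|^2 - <u,v>^2)] is 16 times the squared area of the triangle
   [0, u, v]: the inequality says that its circumradius is at least 1. *)
Definition thick_triple u v :=
  4 * (dotp u u * dotp v v - dotp u v ^+ 2) <=
  dotp u u * dotp v v * dotp (u - v) (u - v).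

(** The two scalar products say that [w] is equidistant from [0], [u] and [v]; [s] and [t] solve
    this linear system by Cramer's rule. The last equation is the classical formula: circumradius =
    product of the sides / (4 area). *)
Lemma triangle_circumcenter u v : 0 < dotp u u * dotp v v - dotp u v ^+ 2 ->
  exists s t : R, let w := s *: u + t *: v in
  [/\ dotp w u = dotp u u / 2, dotp w v = dotp v v / 2 &
      4 * (dotp u u * dotp v v - dotp u v ^+ 2) * dotp w w =
      dotp u u * dotp v v * dotp (u - v) (u - v)].
Proof.
have -> : dotp (u - v) (u - v) = dotp u u + dotp v v - 2 * dotp u v.
  by rewrite !dotpE [dotp v u]dotpC; ring.
set a := dotp u u; set b := dotp v v; set k := dotp u v => G0.
exists (b * (a - k) / (2 * (a * b - k ^+ 2))).
exists (a * (b - k) / (2 * (a * b - k ^+ 2))) => w.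
have G : a * b - k ^+ 2 != 0 by rewrite gt_eqF.
have wu : dotp w u = a / 2.
  by rewrite /w !dotpE -/a [dotp v u]dotpC -/k; field.
have wv : dotp w v = b / 2.
  by rewrite /w !dotpE -/b -/k; field.
split=> //; rewrite {2}/w dotpDr !dotpZr wu wv; field.
exact: G.
Qed.

Lemma thickness_triple L x y z : thickness L = 1%E ->
  L x -> L y -> L z -> x <> y -> y <> z -> x <> z ->
  thick_triple (y - x) (z - x).
Proof.
move=> thL Lx Ly Lz xy yz xz; rewrite /thick_triple.
(* A nonpositive Gram determinant means a collinear triple, for which the claim is trivial. *)
have [G0|G0] := lerP (dotp (y - x) (y - x) * dotp (z - x) (z - x) -
                      dotp (y - x) (z - x) ^+ 2) 0.
  apply: (@le_trans _ _ 0); first by lra.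
  by rewrite !mulr_ge0// dotp_ge0.
have norm_eq (w q : 'rV[R]_3) :
    dotp w q = dotp q q / 2 -> vnorm w = vnorm (w - q).
  by rewrite /vnorm !dotpE [dotp q w]dotpC => ->; congr Num.sqrt; lra.
have [s [t /=]] := triangle_circumcenter G0.
set w := s *: _ + _ => -[wu wv <-].
suff w1 : 1 <= dotp w w by rewrite ler_peMr// mulr_ge0// ltW.
rewrite -sqr_vnorm expr_ge1 ?vnorm_ge0// -lee_fin -thL.
apply: (@le_trans _ _ (circumradius x y z)).
  by apply: ereal_inf_lbound; exists x, y, z.
apply: ereal_inf_lbound; exists (x + w) => /=; last first.
  by rewrite edistE addrAC subrr add0r.
split; first by exists s, t; rewrite -addrA.
have wx : x + w - x = w by rewrite addrAC subrr add0r.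
have wyx (p : 'rV[R]_3) : x + w - p = w - (p - x).
  by apply/rowP => i; rewrite !mxE; ring.
have dist_eq (p : 'rV[R]_3) : dotp w (p - x) = dotp (p - x) (p - x) / 2 ->
    edist (x + w) x = edist (x + w) p.
  by rewrite !edistE wx wyx; exact: norm_eq.
by split; apply: dist_eq.
Qed.

(** By the law of sines the angle at [0] has sine [|u - v| / (2 R)], where the circumradius [R] is
    at least 1. So the sine is at most 1/2 and the cosine at least [sqrt 3 / 2 > 3/4] in absolute
    value. *)
Lemma thick_triple_flat u v :
  u != 0 -> v != 0 -> thick_triple u v -> dotp (u - v) (u - v) <= 1 ->
  3 / 4 * (vnorm u * vnorm v) <= `|dotp u v|.
Proof.
move=> u0 v0; rewrite /thick_triple -!sqr_vnorm.
have pu : 0 < vnorm u by rewrite vnorm_gt0.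
have pv : 0 < vnorm v by rewrite vnorm_gt0.
set p := vnorm u in pu *; set q := vnorm v in pv *; set k := dotp u v.
move=> H uv1.
have pq0 : 0 <= 3 / 4 * (p * q) by rewrite !mulr_ge0// ltW.
rewrite -ler_sqr ?nnegrE// real_normK ?num_real//.
have : 0 <= p ^+ 2 * q ^+ 2 by rewrite mulr_ge0 ?sqr_ge0.
rewrite exprMn; move: H; set c := vnorm (u - v) ^+ 2 in uv1 *.
rewrite !exprMn; set e := p ^+ 2 * q ^+ 2 => H e0.
have : e * c <= e by rewrite ler_piMr.
by lra.
Qed.

(** An angle opposite a longest side is at least [pi / 3], so its cosine is at most 1/2; of the two
    flat cases only the obtuse one remains. *)
Lemma thick_triple_longest u v :
  u != 0 -> v != 0 -> thick_triple u v ->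
  dotp (u - v) (u - v) <= 1 ->
  vnorm u <= vnorm (u - v) -> vnorm v <= vnorm (u - v) ->
  dotp u v <= - (3 / 4) * (vnorm u * vnorm v).
Proof.
move=> u0 v0 tt uv1 ule vle.
have := thick_triple_flat u0 v0 tt uv1.
have pu : 0 < vnorm u by rewrite vnorm_gt0.
have pv : 0 < vnorm v by rewrite vnorm_gt0.
have [k0|k0] := lerP 0 (dotp u v); last by rewrite ltr0_norm//; lra.
have ul : vnorm u ^+ 2 <= vnorm (u - v) ^+ 2.
  by rewrite ler_pXn2r// nnegrE vnorm_ge0.
have vl : vnorm v ^+ 2 <= vnorm (u - v) ^+ 2.
  by rewrite ler_pXn2r// nnegrE vnorm_ge0.
have E : vnorm (u - v) ^+ 2 = vnorm u ^+ 2 + vnorm v ^+ 2 - 2 * dotp u v.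
  by rewrite !sqr_vnorm !dotpE [dotp v u]dotpC; ring.
rewrite ger0_norm// => H; exfalso.
set p := vnorm u in pu ul vl E H; set q := vnorm v in pv ul vl E H.
have pq : 0 < p * q by rewrite mulr_gt0.
have [h|h] := lerP p q.
  have : p ^+ 2 <= p * q by rewrite expr2 ler_pM2l.
  by lra.
have : q ^+ 2 <= p * q by rewrite expr2 ler_pM2r// ltW.
by lra.
Qed.

End Thickness.

(** * Closed curves and the distance between two components *)

Section ClosedCurves.
Variable R : realType.

Lemma closed_curve_nat d (g : R -> 'rV[R]_d) (n : nat) t :
  closed_curve g -> g (t + n%:R) = g t.
Proof.
move=> [_ per]; elim: n t => [|n IH] t; first by rewrite addr0.
by rewrite -natr1 addrA per IH.
Qed.

Lemma closed_curve_int d (g : R -> 'rV[R]_d) (n : int) t :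
  closed_curve g -> g (t + n%:~R) = g t.
Proof.
case: n => n cg; first exact: closed_curve_nat.
by rewrite NegzE mulrNz -(closed_curve_nat n.+1 (t - n.+1%:R) cg) subrK.
Qed.

Lemma closed_curve_frac d (g : R -> 'rV[R]_d) t :
  closed_curve g -> g (t - (Num.floor t)%:~R) = g t.
Proof. by move=> cg; rewrite -mulrNz closed_curve_int. Qed.

Lemma frac_itv (t : R) : t - (Num.floor t)%:~R \in `[0, 1[.
Proof.
rewrite in_itv/= subr_ge0 floor_le_tmp/= ltrBlDl.
by have := floorD1_gt t; rewrite intrD addrC.
Qed.

Lemma closed_curve_param d (g : R -> 'rV[R]_d) x :
  closed_curve g -> range g x -> exists2 t, 0 <= t < 1 & g t = x.
Proof.
move=> cg [t _ <-]; exists (t - (Num.floor t)%:~R); last exact: closed_curve_frac.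
by have := frac_itv t; rewrite in_itv.
Qed.

Lemma compact_closed_curve d (g : R -> 'rV[R]_d) :
  closed_curve g -> compact (range g).
Proof.
move=> cg.
have -> : range g = g @` `[0, 1].
  apply/seteqP; split=> x; last by case=> t _ <-; exists t.
  move=> /(closed_curve_param cg)[t /andP[t0 t1] <-]; exists t => //=.
  by rewrite in_itv/= t0 ltW.
apply: continuous_compact; last exact: segment_compact.
by apply: continuous_subspaceT => t; exact: cg.1.
Qed.

Lemma simple_closed_curve_neq d (g : R -> 'rV[R]_d) s t :
  simple_closed_curve g -> s < t -> t < s + 1 -> g s != g t.
Proof.
move=> [cg inj] st ts1; apply/eqP => gst.
have : s - (Num.floor s)%:~R = t - (Num.floor t)%:~R.
  by apply: inj; rewrite ?inE/= ?frac_itv// !closed_curve_frac.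
move/eqP; rewrite subr_eq -addrA -subr_eq0 opprD addrA => /eqP H.
have E : t - s = (Num.floor t - Num.floor s)%:~R.
  by rewrite intrB; lra.
have : 0 < t - s by lra.
have : t - s < 1 by lra.
by rewrite E ltr0z -[1]/(1%:~R) ltr_int; lia.
Qed.

Lemma compact_dist_attained d (A B : set 'rV[R]_d) :
  compact A -> compact B -> A !=set0 -> B !=set0 ->
  exists a b, [/\ A a, B b &
    forall x y, A x -> B y -> edist a b <= edist x y].
Proof.
move=> cA cB [a Aa] [b Bb].
have cAB := compact_setX cA cB.
have nAB : (A `*` B) !=set0 by exists (a, b).
have cf : {within A `*` B, continuous (fun p : 'rV[R]_d * 'rV[R]_d => edist p.1 p.2)}.
  apply: continuous_subspaceT; apply: continuous_edist => p.
    exact: cvg_fst.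
  exact: cvg_snd.
have [[x y]] := compact_EVT_min nAB cAB cf.
rewrite inE => -[/= Ax By] H; exists x, y; split=> // x' y' Ax' By'.
by apply: (H (x', y')); rewrite inE.
Qed.

Lemma compact_dist_gt0 d (A B : set 'rV[R]_d) :
  compact A -> compact B -> (forall x, A x -> ~ B x) ->
  exists2 e, 0 < e & forall x y, A x -> B y -> e <= edist x y.
Proof.
move=> cA cB AB.
have [A0|/set0P/negP] := pselect (A !=set0); last first.
  by rewrite negbK => /eqP A0; exists 1 => // x y; rewrite A0.
have [B0|/set0P/negP] := pselect (B !=set0); last first.
  by rewrite negbK => /eqP B0; exists 1 => // x y _; rewrite B0.
have [a [b [Aa Bb H]]] := compact_dist_attained cA cB A0 B0.
exists (edist a b) => //; rewrite edist_gt0; apply/eqP => ab.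
by apply: (AB a) => //; rewrite ab.
Qed.

(* The triple [x, x + u, x + v] bounds [u + v] since [u] and [v] have the same
   small length [sqrt e], so both are almost orthogonal to [y]; the circle
   through [x, x + u, x + y] then has diameter about [|y|]. *)
Lemma thick_triples_bound (u v y : 'rV[R]_3) e :
  0 < e -> e <= 1 -> dotp u u = e -> dotp v v = e -> u != v ->
  dotp y y < 4 -> dotp y y <= dotp (u - y) (u - y) ->
  dotp y y <= dotp (v - y) (v - y) ->
  thick_triple u v -> thick_triple u y ->
  dotp y y * (4 - dotp y y) <= 49 * e.
Proof.
move=> e0 e1 uu vv uv y4; have y0 := dotp_ge0 y.
have CS := cauchy_schwarz_sqr (u + v) y.
have : 0 < dotp (u - v) (u - v) by rewrite dotp_gt0 subr_eq0.
move: CS; rewrite /thick_triple !dotpE uu vv.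
rewrite [dotp v u]dotpC [dotp y u]dotpC [dotp y v]dotpC.
move: y0 y4; set D := dotp y y; set c := dotp u v.
set a := dotp u y; set b := dotp v y => D0 D4 CS uv0 ua vb T1 T2.
(* The left side is [|u + v|^2]: a thick isosceles triangle with legs [sqrt e] is so flat that
   [|u + v| <= e]. With [|y| < 2], Cauchy-Schwarz then bounds [a + b] by [2 * e]. *)
have ec : 2 * (e + c) <= e ^+ 2.
  have : 0 <= (e - c) * (e ^+ 2 - 2 * (e + c)) by lra.
  by rewrite pmulr_rge0; lra.
have ab : (a + b) ^+ 2 <= (2 * e) ^+ 2.
  apply: (le_trans CS); rewrite exprMn.
  have : (e + c + (c + e)) * D <= e ^+ 2 * D by rewrite ler_wpM2r//; lra.
  have : e ^+ 2 * D <= e ^+ 2 * 4 by rewrite ler_wpM2l ?sqr_ge0// ltW.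
  by lra.
have {}ab : - (2 * e) <= a + b.
  by move: ab; rewrite -[X in X <= _]real_normK ?num_real// ler_sqr ?nnegrE//;
    [rewrite ler_norml => /andP[]|lra].
(* Neither [u] nor [v] is closer to [y] than [0] is, so [a] and [b] are at most [e / 2]; the bound
   on [a + b] turns this into a lower bound for [a]. *)
have a1 : a <= e / 2 by lra.
have a2 : - (5 / 2 * e) <= a by lra.
have aa : a ^+ 2 <= 25 / 4 * e ^+ 2.
  have : 0 <= (5 / 2 * e - a) * (5 / 2 * e + a) by rewrite mulr_ge0//; lra.
  by lra.
have aD : e * D * (- (5 * e)) <= e * D * (2 * a).
  by rewrite ler_wpM2l ?mulr_ge0//; lra.
(* In [T2], [49 = 25 + 4 + 20]: the terms come from [4 * a^2], from [e^2 * D] and from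
   [- 2 * a * e * D], with [D < 4]. *)
have : 0 <= e * (49 * e - D * (4 - D)).
  have : e * (e * D) <= e * (e * 4) by rewrite !ler_wpM2l// ltW.
  by lra.
by rewrite pmulr_rge0// subr_ge0.
Qed.

Lemma edist_intermediate d (g : R -> 'rV[R]_d) x a b e :
  continuous g -> a <= b ->
  edist (g a) x <= e <= edist (g b) x \/ edist (g b) x <= e <= edist (g a) x ->
  exists2 t, a <= t <= b & edist (g t) x = e.
Proof.
move=> cg ab H.
have cf : {within `[a, b], continuous (fun t => edist (g t) x)}.
  by apply: continuous_subspaceT; apply: continuous_edist => //; exact: cst_continuous.
have [|t] := @IVT R _ a b e ab cf; last by rewrite in_itv/= => tab <-; exists t.
case: H => /andP[h1 h2]; have h3 := le_trans h1 h2.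
  by rewrite (min_idPl h3) (max_idPr h3) h1.
by rewrite (min_idPr h3) (max_idPl h3) h1.
Qed.

(** Let [p], [q] be a closest pair. Near [p], the curve [g] has two points at the same small
    distance from [p], one on each side; [thick_triples_bound] for them makes [D * (4 - D)]
    arbitrarily small, where [D = |p - q|^2], which excludes [0 < D < 4]. *)
Lemma component_dist_ge2 L (g h : R -> 'rV[R]_3) x y :
  thickness L = 1%E -> range g `<=` L -> range h `<=` L ->
  simple_closed_curve g -> closed_curve h ->
  (forall z, range g z -> ~ range h z) ->
  range g x -> range h y -> 2 <= edist x y.
Proof.
move=> thL gL hL sg ch gh gx hy.
have cg := sg.1.
have [p [q [gp hq pq_min]]] := compact_dist_attained (compact_closed_curve cg)
  (compact_closed_curve ch) (ex_intro _ x gx) (ex_intro _ y hy).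
apply: le_trans (pq_min _ _ gx hy).
have pq_neq : p != q by apply/eqP => pq; apply: (gh p) => //; rewrite pq.
have [//|pq2] := leP 2 (edist p q).
have [t0 _ gt0] := closed_curve_param cg gp.
set D := dotp (q - p) (q - p).
have D_gt0 : 0 < D by rewrite dotp_gt0 subr_eq0 eq_sym.
have D_lt4 : D < 4.
  rewrite /D -sqr_edist edistC.
  have -> : 4 = 2 ^+ 2 :> R by ring.
  by rewrite ltr_pXn2r// nnegrE ?edist_ge0.
pose D1 := edist (g (t0 + 1 / 2)) p.
have D1_gt0 : 0 < D1.
  rewrite edist_gt0 -gt0 eq_sym; apply: simple_closed_curve_neq => //; lra.
(* Being below [D1], the distance [e] is attained on both halves of the curve; the factor 50
   contradicts the final bound [49 * e ^+ 2], since [e ^+ 2 <= e]. *)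
pose e := Num.min (Num.min 1 (D1 / 2)) (D * (4 - D) / 50).
have DD : 0 < D * (4 - D) by rewrite mulr_gt0// subr_gt0.
have e0 : 0 < e by rewrite /e !lt_min ltr01 !divr_gt0.
have e1 : e <= 1 by rewrite /e !ge_min lexx.
have eD1 : e < D1.
  by apply: (@le_lt_trans _ _ (D1 / 2)); [rewrite /e !ge_min lexx orbT|lra].
have eD : e <= D * (4 - D) / 50 by rewrite /e !ge_min lexx !orbT.
have t01 : edist (g t0) p = 0 by rewrite gt0 edist_xx.
have t11 : edist (g (t0 + 1)) p = 0 by rewrite cg.2 gt0 edist_xx.
have half : t0 <= t0 + 1 / 2 by lra.
have half' : t0 + 1 / 2 <= t0 + 1 by lra.
have [|s sI es] := @edist_intermediate _ g p _ _ e cg.1 half.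
  by left; rewrite t01 !ltW.
have [|s' sI' es'] := @edist_intermediate _ g p _ _ e cg.1 half'.
  by right; rewrite t11 !ltW.
have neq t : edist (g t) p = e -> [/\ t != t0, t != t0 + 1 / 2 & t != t0 + 1].
  move=> H; split; apply: contra_eq_neq H => ->; by
    rewrite ?t01 ?t11 -/D1 neq_lt ?e0 ?eD1 ?orbT.
have [s1 s2 _] := neq _ es; have [_ s3 s4] := neq _ es'.
have ss' : g s != g s'.
  case/andP: sI => a1 a2; case/andP: sI' => b1 b2.
  have : s < t0 + 1 / 2 by rewrite lt_neqAle s2.
  have : t0 < s by rewrite lt_neqAle eq_sym s1.
  by move=> ? ?; apply: simple_closed_curve_neq => //; lra.
have gsp : g s != p by rewrite -edist_gt0 es.
have gsp' : g s' != p by rewrite -edist_gt0 es'.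
have Lg t : L (g t) by apply: gL; exists t.
have Lp : L p by exact: gL.
have Lq : L q by exact: hL.
have gsq t : g t != q.
  by apply/eqP => gt; apply: (gh (g t)); [exists t|rewrite gt].
have sub t : g t - p - (q - p) = g t - q by rewrite opprB addrA subrK.
have D_le t : D <= dotp (g t - p - (q - p)) (g t - p - (q - p)).
  rewrite sub /D -!sqr_edist edistC ler_sqr ?nnegrE ?edist_ge0//.
  by apply: pq_min => //; exists t.
suff : D * (4 - D) <= 49 * e ^+ 2.
  have : e ^+ 2 <= e by rewrite expr2 ler_piMr// ltW.
  by lra.
apply: (@thick_triples_bound (g s - p) (g s' - p) (q - p)) => //.
- by rewrite exprn_gt0.
- by rewrite expr_le1// ltW.
- by rewrite -sqr_edist es.
- by rewrite -sqr_edist es'.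
- by apply: contra_neq ss' => /addIr.
- by apply: (thickness_triple thL) => //; apply/eqP; rewrite // eq_sym.
- by apply: (thickness_triple thL) => //; apply/eqP; rewrite // eq_sym.
Qed.

End ClosedCurves.

(** * Thick sets are one-dimensional *)

Section Packing.
Variable R : realType.
Implicit Types (S : set 'rV[R]_3) (x y z u v w : 'rV[R]_3).

Definition thick_set S := forall x y z, S x -> S y -> S z ->
  x != y -> y != z -> x != z -> thick_triple (y - x) (z - x).

Lemma subr_sub3 (V : zmodType) (x y z : V) : x - z - (y - z) = x - y.
Proof. by rewrite opprB addrA subrK. Qed.

Lemma sqr_edist_expand x y z :
  edist x y ^+ 2 = edist x z ^+ 2 + edist y z ^+ 2 - 2 * dotp (x - z) (y - z).
Proof.
rewrite !sqr_edist -(subr_sub3 x y z); move: (x - z) (y - z) => u v.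
by rewrite !dotpE [dotp v u]dotpC; ring.
Qed.

(** Law of cosines at [z], where the cosine is at most -3/4. *)
Lemma thick_set_longest S x y z : thick_set S -> S x -> S y -> S z ->
  x != y -> y != z -> x != z -> edist x y <= 1 ->
  edist x z <= edist x y -> edist y z <= edist x y ->
  edist x z ^+ 2 + edist y z ^+ 2 + 3 / 2 * (edist x z * edist y z)
    <= edist x y ^+ 2.
Proof.
move=> tS Sx Sy Sz xy yz xz xy1 lx ly.
have : dotp (x - z) (y - z) <= - (3 / 4) * (vnorm (x - z) * vnorm (y - z)).
  apply: thick_triple_longest; rewrite ?subr_eq0// ?subr_sub3 -?edistE//.
    by apply: tS => //; rewrite // eq_sym.
  by rewrite -sqr_edist expr_le1// edist_ge0.
by rewrite (sqr_edist_expand x y z) !edistE; lra.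
Qed.

Lemma thick_set_longest_gap S x y z : thick_set S -> S x -> S y -> S z ->
  x != y -> y != z -> x != z -> edist x y <= 1 ->
  edist x z <= edist x y -> edist y z <= edist x y ->
  edist x z + edist y z / 2 <= edist x y.
Proof.
move=> tS Sx Sy Sz xy yz xz xy1 lx ly.
have := thick_set_longest tS Sx Sy Sz xy yz xz xy1 lx ly.
move=> H; rewrite -ler_sqr ?nnegrE ?edist_ge0 ?addr_ge0 ?divr_ge0 ?edist_ge0//.
move: H.
have := edist_ge0 x z; have := edist_ge0 y z.
set a := edist x z; set b := edist y z => a0 b0 H.
have : 0 <= a * b by rewrite mulr_ge0.
have := sqr_ge0 b.
by lra.
Qed.

(** With [a], [b], [c] the sides [xz], [yz], [xy], the law of cosines at [x] and [thick_set_longest]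
    give twice the scalar product at least [2 a^2 + 3/2 a b], hence at least
    [3/2 a (a + b) >= 3/2 a c]. *)
Lemma thick_set_longest_angle S x y z : thick_set S -> S x -> S y -> S z ->
  x != y -> y != z -> x != z -> edist x y <= 1 ->
  edist x z <= edist x y -> edist y z <= edist x y ->
  3 / 4 * (vnorm (z - x) * vnorm (y - x)) <= dotp (z - x) (y - x).
Proof.
move=> tS Sx Sy Sz xy yz xz xy1 lx ly.
have := thick_set_longest tS Sx Sy Sz xy yz xz xy1 lx ly.
have := sqr_edist_expand z y x; have := edist_triangle x z y.
rewrite -!edistE ![edist z _]edistC [edist y x]edistC.
have := edist_ge0 x z; have := edist_ge0 y z.
set a := edist x z; set b := edist y z; set c := edist x y => a0 b0 tri E H.
have : a * c <= a * (a + b) by rewrite ler_wpM2l.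
have := sqr_ge0 a.
by lra.
Qed.

(** The sum of the unit vectors along [u] and [v] has squared norm at most 1/2, yet its scalar
    product with the unit vector along [y] would be at least 3/2. *)
Lemma no_three_spread_directions u v y : u != 0 -> v != 0 -> y != 0 ->
  dotp u v <= - (3 / 4) * (vnorm u * vnorm v) ->
  3 / 4 * (vnorm u * vnorm y) <= dotp u y ->
  3 / 4 * (vnorm v * vnorm y) <= dotp v y -> False.
Proof.
rewrite -!vnorm_gt0 => u0 v0 y0 uv uy vy.
have := cauchy_schwarz_sqr (vnorm v *: u + vnorm u *: v) y.
rewrite !dotpE [dotp v u]dotpC -!sqr_vnorm.
move: u0 v0 y0 uv uy vy; set a := vnorm u; set b := vnorm v; set c := vnorm y.
move=> a0 b0 c0 uv uy vy.
have h1 : 3 / 2 * (a * b * c) <= b * dotp u y + a * dotp v y.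
  have : b * (3 / 4 * (a * c)) <= b * dotp u y by rewrite ler_pM2l.
  have : a * (3 / 4 * (b * c)) <= a * dotp v y by rewrite ler_pM2l.
  by lra.
have h2 : a * b * dotp u v <= a * b * (- (3 / 4) * (a * b)).
  by rewrite ler_pM2l// mulr_gt0.
have abc : 0 < a * b * c by rewrite !mulr_gt0.
have h3 : (3 / 2 * (a * b * c)) ^+ 2 <= (b * dotp u y + a * dotp v y) ^+ 2.
  by rewrite ler_sqr ?nnegrE//; lra.
have h4 : a * b * dotp u v * c ^+ 2 <= a * b * (- (3 / 4) * (a * b)) * c ^+ 2.
  by rewrite ler_wpM2r ?sqr_ge0.
have : 0 < (a * b * c) ^+ 2 by rewrite exprn_gt0.
by lra.
Qed.

(** Seen from an end [x] of a diametral pair, [S] behaves like an arc starting at [x], with the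
    distance to [x] as a parameter. If [zw] is not the longest side of [x z w], the gap lemma
    applies. Otherwise [z] and [w] lie in nearly opposite directions from [x], although both lie in
    nearly the direction of [y]. *)
Lemma thick_set_radial_gap S x y z w : thick_set S ->
  S x -> S y -> S z -> S w -> x != y -> z != w -> edist x y <= 1 ->
  (forall p q, S p -> S q -> edist p q <= edist x y) ->
  edist z w / 2 <= `|edist z x - edist w x|.
Proof.
move=> tS Sx Sy + + xy + xy1 diam.
wlog : z w / edist w x <= edist z x.
  move=> H Sz Sw zw; have [h|h] := leP (edist w x) (edist z x); first exact: H.
  by rewrite edistC distrC H// 1?eq_sym// ltW.
move=> wz Sz Sw zw; rewrite ger0_norm ?subr_ge0//.
have le1 p q : S p -> S q -> edist p q <= 1.
  by move=> Sp Sq; apply: le_trans (diam _ _ Sp Sq) xy1.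
have [->|wx] := eqVneq w x.
  by rewrite edist_xx; have := edist_ge0 z x; lra.
have [zx|zx] := eqVneq z x.
  move: wz; rewrite zx edist_xx => h.
  by move: wx; rewrite -edist_gt0; lra.
have [zwl|zwl] := leP (edist z w) (edist z x).
  have := @thick_set_longest_gap S x z w tS Sx Sz Sw.
  rewrite ![edist x _]edistC.
  by rewrite ![x == _]eq_sym zx wx zw le1// wz zwl => /(_ _ _ _ _ _)/=; lra.
exfalso.
have zy : z != y.
  by apply: contraTneq zwl => ->; rewrite -leNgt (edistC y x) diam.
have wy : w != y.
  apply: contraTneq zwl => wy; rewrite -leNgt wy in wz *.
  by apply: le_trans wz; rewrite [edist y x]edistC diam.
have ang p : S p -> p != x -> p != y ->
    3 / 4 * (vnorm (p - x) * vnorm (y - x)) <= dotp (p - x) (y - x).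
  move=> Sp px py; apply: (thick_set_longest_angle tS) => //; rewrite 1?eq_sym//.
    exact: diam.
  by rewrite diam.
apply: (@no_three_spread_directions (z - x) (w - x) (y - x));
  rewrite ?subr_eq0// 1?eq_sym//; try exact: ang.
apply: thick_triple_longest; rewrite ?subr_eq0// ?subr_sub3 -?edistE ?(ltW zwl)//.
- by apply: tS => //; rewrite eq_sym.
- by rewrite -sqr_edist expr_le1 ?edist_ge0// le1.
- by apply: le_trans wz _; exact: ltW.
Qed.

Lemma ltr_norm_truncn (a b : R) : 0 <= a -> 0 <= b ->
  Num.truncn a = Num.truncn b -> `|a - b| < 1.
Proof.
move=> a0 b0 ab.
have /andP[a1 a2] := truncn_itv a0; have /andP[b1 b2] := truncn_itv b0.
by rewrite ab in a1 a2; rewrite ltr_norml; apply/andP; move: a2 b2; rewrite -!natr1; lra.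
Qed.

(** By [thick_set_radial_gap], the distances to one end of a diametral pair are numbers in [[0, 1]]
    that differ pairwise by at least [e / 2], so they fall into distinct cells of that width. *)
Lemma thick_set_packing S (I : finType) (A : {set I}) (F : I -> 'rV[R]_3) e :
  thick_set S -> 0 < e -> (forall i, i \in A -> S (F i)) ->
  (forall i j, i \in A -> j \in A -> i != j -> e <= edist (F i) (F j) <= 1) ->
  #|A|%:R <= 2 / e + 1.
Proof.
move=> tS e0 SF dF.
have e2 : 0 <= 2 / e by rewrite divr_ge0// ltW.
have [|/card_gt1P[i0 [i1 [Ai0 Ai1 i01]]]] := leqP #|A| 1%N.
  by rewrite -(ler_nat R) => h; lra.
have inj i j : i \in A -> j \in A -> F i = F j -> i = j.
  move=> Ai Aj Fij; apply/eqP; apply: contraTT isT => ij.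
  by have := dF _ _ Ai Aj ij; rewrite Fij edist_xx; lra.
have [[p q] /= Apq pq_max] :=
  @arg_maxP _ _ _ (i0, i1) (fun pq => (pq.1 \in A) && (pq.2 \in A))
    (fun pq : I * I => edist (F pq.1) (F pq.2)) (introT andP (conj Ai0 Ai1)).
have /andP[Ap Aq] := Apq.
have diam i j : i \in A -> j \in A -> edist (F i) (F j) <= edist (F p) (F q).
  by move=> Ai Aj; apply: (pq_max (i, j)); rewrite /= Ai.
have pq : F p != F q.
  rewrite -edist_gt0; apply: lt_le_trans (diam _ _ Ai0 Ai1).
  by apply: lt_le_trans e0 _; case/andP: (dF _ _ Ai0 Ai1 i01).
have le1 i j : i \in A -> j \in A -> edist (F i) (F j) <= 1.
  move=> Ai Aj; have [->|ij] := eqVneq i j; first by rewrite edist_xx.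
  by case/andP: (dF _ _ Ai Aj ij).
pose S' := [set F i | i in [set i | i \in A]].
have tS' : thick_set S'.
  by move=> _ _ _ [i Ai <-] [j Aj <-] [k Ak <-]; apply: tS; exact: SF.
have gap i j : i \in A -> j \in A -> i != j ->
    e / 2 <= `|edist (F i) (F p) - edist (F j) (F p)|.
  move=> Ai Aj ij.
  have H : edist (F i) (F j) / 2 <= `|edist (F i) (F p) - edist (F j) (F p)|.
    apply: (@thick_set_radial_gap S' (F p) (F q)) => //; try by eexists; last reflexivity.
    - by apply: contra_neq ij; exact: inj.
    - exact: le1.
    - by move=> _ _ [k Ak <-] [l Al <-]; exact: diam.
  by apply: le_trans H; case/andP: (dF _ _ Ai Aj ij) => h _; lra.
pose f i := Num.truncn (edist (F i) (F p) * (2 / e)).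
have fI : {in A &, injective f}.
  move=> i j Ai Aj fij; apply/eqP; apply: contraTT isT => ij.
  have := ltr_norm_truncn (mulr_ge0 (edist_ge0 (F i) (F p)) e2)
    (mulr_ge0 (edist_ge0 (F j) (F p)) e2) fij.
  rewrite -mulrBl normrM (ger0_norm e2).
  have : e / 2 * (2 / e) <= `|edist (F i) (F p) - edist (F j) (F p)| * (2 / e).
    by rewrite ler_wpM2r// gap.
  have -> : e / 2 * (2 / e) = 1 by field; rewrite gt_eqF.
  by move=> h1 h2; lra.
pose Q := Num.truncn (2 / e).
have fQ i : i \in A -> (f i < Q.+1)%N.
  move=> Ai; rewrite ltnS; apply: le_truncn.
  by rewrite ler_piMl// le1.
have : (#|A| <= #|'I_Q.+1|)%N.
  rewrite -(card_in_imset (f := fun i => inord (f i) : 'I_Q.+1)) ?max_card//.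
  move=> i j Ai Aj /(congr1 val); rewrite /= !inordK ?fQ//.
  exact: fI.
rewrite card_ord -(ler_nat R) => h; apply: le_trans h _.
by rewrite -natr1 lerD2r; case/andP: (truncn_itv e2).
Qed.


Definition slope_dir (a b : R) : 'rV[R]_3 := \row_(i < 3) [:: a; b; 1]`_i.

Lemma slope_dirE a b : [/\ slope_dir a b ord0 0 = a, slope_dir a b ord0 1 = b &
  slope_dir a b ord0 2 = 1].
Proof. by split; rewrite mxE. Qed.

(** The last coordinate of the difference is [t - t']. Subtracting [a'] times it from the first
    coordinate leaves [t * (a - a')]; two coordinates are used, hence the factor 2. *)
Lemma slope_dir_separated a b a' b' t t' (e : R) :
  0 <= a' <= 1 -> 0 <= b' <= 1 -> e <= `|a - a'| \/ e <= `|b - b'| ->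
  `|t| * e <= 2 * vnorm (t *: slope_dir a b - t' *: slope_dir a' b').
Proof.
move=> a01 b01.
set w := t *: _ - _; have [d0 d1 d2] := slope_dirE a b.
have [d0' d1' d2'] := slope_dirE a' b'.
have w0 : w ord0 0 = t * (a - a') + (t - t') * a'.
  by rewrite [LHS]mxE [in LHS]mxE d0 !mxE/=; ring.
have w1 : w ord0 1 = t * (b - b') + (t - t') * b'.
  by rewrite [LHS]mxE [in LHS]mxE d1 !mxE/=; ring.
have w2 : w ord0 2 = t - t'.
  by rewrite [LHS]mxE [in LHS]mxE d2 !mxE/=; ring.
have := coord_le_vnorm w 2; have := coord_le_vnorm w 1.
have := coord_le_vnorm w 0; rewrite w0 w1 w2.
have key (c c' : R) : 0 <= c' <= 1 -> e <= `|c| ->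
    `|t| * e <= `|t * c + (t - t') * c'| + `|t - t'|.
  move=> /andP[c0 c1] ec.
  apply: (@le_trans _ _ (`|t * c|)); first by rewrite normrM ler_wpM2l.
  have {1}-> : t * c = t * c + (t - t') * c' - (t - t') * c' by ring.
  apply: (le_trans (ler_normB _ _)); rewrite lerD2l normrM (ger0_norm c0).
  by rewrite ler_piMr.
move=> v0 v1 v2 [/(key _ _ a01)|/(key _ _ b01)] => H; apply: le_trans H _; lra.
Qed.

Lemma grid_gap N (i j : 'I_N) :
  i != j -> N%:R^-1 <= `|i%:R / N%:R - j%:R / N%:R| :> R.
Proof.
move=> ij; have N0 : (0 < N)%N := leq_ltn_trans (leq0n i) (ltn_ord i).
rewrite -mulrBl normrM normfV normr_nat ler_peMl ?invr_ge0//.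
have : (i < j)%N || (j < i)%N by rewrite -neq_ltn.
move=> /orP[] ij'; [rewrite distrC|];
  by rewrite -natrB ?normr_nat ?(ler_nat R 1) ?subn_gt0 ?ij'// ltnW.
Qed.

(* If [S] met each of the [N ^ 2] lines, it would contain [N ^ 2] points at mutual
   distances of order [1 / N], but a thick set has room for only [O(N)] of them. *)
Lemma thick_set_generic_line S p (del M : R) : thick_set S -> 0 < del ->
  (forall x, S x -> del <= edist x p <= M) ->
  exists a b, forall t, ~ S (p + t *: slope_dir a b).
Proof.
move=> tS del0 SM; apply: contrapT => H.
have {}H a b : exists t, S (p + t *: slope_dir a b).
  by apply: contrapT => Hab; apply: H; exists a, b => t St; apply: Hab; exists t.
(* The box of half-side [M] around [p] is cut into at most [Q ^ 3] cubes of side 1/2, whose diameter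
   is below 1, as the packing bound requires. *)
have [Q QE] : exists Q, Q = (Num.truncn (4 * M)).+1 by eexists.
have : exists C : R, C = (Q ^ 3)%N%:R by eexists.
move=> [C CE].
have C0 : 0 <= C by rewrite CE ler0n.
(* Packing allows at most [C * (2 / e + 1) = C * (12 / del * N + 1)] points, which is less than
   [N ^ 2] for this [N]. *)
have [N [NC N1]] : exists N : nat, C * (12 / del + 1) < N%:R /\ 1 <= N%:R :> R.
  exists (Num.truncn (C * (12 / del + 1))).+1.
  by split; [exact: truncnS_gt|rewrite ler1n].
pose I := ('I_N * 'I_N)%type.
pose s (i : 'I_N) : R := i%:R / N%:R.
have N0 : 0 < N%:R :> R by rewrite (lt_le_trans _ N1).
have N0' : (0 < N)%N by rewrite -(ltr0n R).
have s01 i : 0 <= s i <= 1.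
  by rewrite divr_ge0//= ler_pdivrMr// mul1r ler_nat ltnW.
have sgap i j : i != j -> N%:R^-1 <= `|s i - s j|.
  exact: grid_gap.
have [t St] := choice (fun i : I => H (s i.1) (s i.2)).
pose v i := t i *: slope_dir (s i.1) (s i.2).
have vB i : del <= vnorm (v i) <= M.
  by have := SM _ (St i); rewrite edistE [p + _]addrC addrK.
have t_ge i : del / 3 <= `|t i|.
  have /andP[+ _] := vB i; rewrite vnormZ.
  have : vnorm (slope_dir (s i.1) (s i.2)) <= 3.
    apply: le_trans (vnorm_le_sum _) _.
    have [d0 d1 d2] := slope_dirE (s i.1) (s i.2).
    rewrite !big_ord_recl big_ord0 !mxE/= normr1.
    have /andP[a0 a1] := s01 i.1; have /andP[b0 b1] := s01 i.2.
    by rewrite !ger0_norm//; lra.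
  move=> h1 h2.
  have : `|t i| * vnorm (slope_dir (s i.1) (s i.2)) <= `|t i| * 3 by rewrite ler_wpM2l.
  by lra.
(* The slopes differ by at least [1 / N], the parameters [t i] are at least [del / 3] in absolute
   value, and [slope_dir_separated] loses a factor 2. *)
pose e := del / (6 * N%:R).
have e0 : 0 < e by rewrite divr_gt0// mulr_gt0.
have sep i j : i != j -> e <= edist (p + v i) (p + v j).
  move=> ij; rewrite edistE opprD addrACA subrr add0r.
  have dij : N%:R^-1 <= `|s i.1 - s j.1| \/ N%:R^-1 <= `|s i.2 - s j.2|.
    have [E|/sgap] := eqVneq i.1 j.1; last by left.
    right; apply: sgap; apply: contra_neq ij.
    by case: i j E => [i1 i2] [j1 j2] /= -> ->.
  have := slope_dir_separated (t i) (t j) (s01 j.1) (s01 j.2) dij.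
  have : del / 3 / N%:R <= `|t i| / N%:R by rewrite ler_pM2r ?invr_gt0.
  rewrite -/(v i) -/(v j).
  have -> : del / 3 / N%:R = 2 * e by rewrite /e; field; rewrite gt_eqF.
  by lra.
have M0 : 0 <= M.
  have /andP[h1 h2] := vB (Ordinal N0', Ordinal N0').
  by apply: le_trans h2; apply: le_trans h1; exact: ltW.
have vM i (k : 'I_3) : 0 <= (v i ord0 k + M) * 2.
  have := coord_le_vnorm (v i) k; have /andP[_ h] := vB i.
  by move=> /le_trans/(_ h); rewrite ler_norml => /andP[h1 h2]; lra.
have vQ i (k : 'I_3) : (Num.truncn ((v i ord0 k + M) * 2) < Q)%N.
  rewrite QE ltnS; apply: le_truncn.
  have := coord_le_vnorm (v i) k; have /andP[_ h] := vB i.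
  by move=> /le_trans/(_ h); rewrite ler_norml => /andP[h1 h2]; lra.
pose cell (i : I) : {ffun 'I_3 -> 'I_Q} := [ffun k => Ordinal (vQ i k)].
have same_cell i j : cell i = cell j -> edist (p + v i) (p + v j) <= 1.
  move=> /ffunP ij; rewrite edistE opprD addrACA subrr add0r.
  rewrite -(@expr_le1 _ 2) ?vnorm_ge0// sqr_vnorm.
  apply: (@le_trans _ _ (\sum_(k < 3) 1 / 4)); last first.
    by rewrite sumr_const card_ord; lra.
  apply: ler_sum => k _; rewrite !mxE.
  have := ij k; rewrite !ffunE => /(congr1 val)/=.
  move=> /(ltr_norm_truncn (vM i k) (vM j k)); rewrite -mulrBl.
  set x := t i * _; set y := t j * _ => h.
  have {h} : `|x - y| <= 1 / 2.
    rewrite ltr_norml in h; case/andP: h => h1 h2.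
    rewrite !mxE in h1 h2.
    by rewrite ler_norml; apply/andP; split; rewrite /x /y; lra.
  move=> h; rewrite -expr2 -real_normK ?num_real//.
  have -> : 1 / 4 = (1 / 2) ^+ 2 :> R by field.
  by rewrite ler_sqr ?nnegrE.
have cellB c : (#|[set i | cell i == c]%SET|%:R : R) <= 2 / e + 1.
  apply: (@thick_set_packing S _ _ (fun i => p + v i)) => //.
  - by move=> i _; exact: St.
  - move=> i j; rewrite !inE => /eqP ci /eqP cj ij.
    by rewrite sep//= same_cell// ci.
have : (N * N)%N%:R <= C * (2 / e + 1).
  have -> : (N * N)%N = (\sum_c #|[set i | cell i == c]%SET|)%N.
    rewrite -[in LHS](card_ord N) -card_prod -sum1_card.
    rewrite (partition_big cell xpredT)//=; apply: eq_bigr => c _.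
    by rewrite -sum1_card; apply: eq_bigl => i; rewrite inE.
  rewrite natr_sum; apply: le_trans (ler_sum _ (fun c _ => cellB c)) _.
  have cardQ : #|{: {ffun 'I_3 -> 'I_Q}}| = (Q ^ 3)%N by rewrite card_ffun !card_ord.
  rewrite sumr_const CE -cardQ -[X in X <= _]mulr_natl.
  exact: lexx.
have -> : 2 / e + 1 = 12 / del * N%:R + 1.
  by rewrite /e; field; rewrite !gt_eqF.
have d0 : 0 < 12 / del by rewrite divr_gt0.
rewrite natrM.
have h1 : C * (12 / del + 1) * N%:R < N%:R * N%:R by rewrite ltr_pM2r.
have h2 : C * 1 <= C * N%:R by rewrite ler_wpM2l.
move=> h3; lra.
Qed.

End Packing.

(** * Linked curves meet cones *)

Section Separation.
Variable R : realType.

Lemma compact_upper_bound (T : topologicalType) (A : set T) (f : T -> R) :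
  compact A -> continuous f -> exists2 M, 0 <= M & forall x, A x -> f x <= M.
Proof.
move=> cA cf.
have [A0|/set0P/negP] := pselect (A !=set0); last first.
  by rewrite negbK => /eqP A0; exists 0 => // x; rewrite A0.
have [c _ H] := compact_EVT_max A0 cA (continuous_subspaceT cf).
exists `|f c| => // x Ax; apply: le_trans (ler_norm _).
by apply: H; rewrite inE.
Qed.

Lemma compact_lower_bound (T : topologicalType) (A : set T) (f : T -> R) :
  compact A -> continuous f -> (forall x, A x -> 0 < f x) ->
  exists2 e, 0 < e & forall x, A x -> e <= f x.
Proof.
move=> cA cf fA.
have [A0|/set0P/negP] := pselect (A !=set0); last first.
  by rewrite negbK => /eqP A0; exists 1 => // x; rewrite A0.
have [c cinA H] := compact_EVT_min A0 cA (continuous_subspaceT cf).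
rewrite inE in cinA.
by exists (f c) => [|x Ax]; [exact: fA|apply: H; rewrite inE].
Qed.

Section SetDistance.
Variables (d : nat) (C : set 'rV[R]_d).
Hypothesis C0 : C !=set0.

Definition setdist (x : 'rV[R]_d) : R := inf [set edist x c | c in C].

Lemma setdist_le x c : C c -> setdist x <= edist x c.
Proof.
move=> Cc; apply: ge_inf; last by exists c.
by exists 0 => _ [z _ <-]; exact: edist_ge0.
Qed.

Lemma setdist_ge x e : (forall c, C c -> e <= edist x c) -> e <= setdist x.
Proof.
move=> H; apply: lb_le_inf; first by case: C0 => c Cc; exists (edist x c), c.
by move=> _ [c Cc <-]; exact: H.
Qed.

Lemma setdist_ge0 x : 0 <= setdist x.
Proof. by apply: setdist_ge => c _; exact: edist_ge0. Qed.

Lemma setdist_eq0 x : C x -> setdist x = 0.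
Proof.
move=> Cx; apply/eqP; rewrite eq_le setdist_ge0 andbT.
by rewrite (le_trans (setdist_le _ Cx))// edist_xx.
Qed.

Lemma setdist_lipschitz x y : `|setdist x - setdist y| <= edist x y.
Proof.
have H u v : setdist u - edist u v <= setdist v.
  apply: setdist_ge => c Cc; rewrite lerBlDl.
  exact: le_trans (setdist_le _ Cc) (edist_triangle _ _ _).
have := H x y; have := H y x; rewrite [edist y x]edistC => h1 h2.
by rewrite ler_norml; apply/andP; split; lra.
Qed.

(** The homothety of ratio [l] about [p] maps [C] into itself and multiplies distances by [l]. *)
Lemma setdist_star p l x : (forall c s, C c -> 0 <= s <= 1 -> C (p + s *: (c - p))) ->
  0 <= l <= 1 -> setdist (p + l *: (x - p)) <= l * setdist x.
Proof.
move=> starC /andP[l0 l1].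
have [l_eq0|lneq0] := eqVneq l 0.
  rewrite l_eq0 mul0r scale0r addr0 setdist_eq0//.
  by case: C0 => c /starC -/(_ 0); rewrite lexx ler01 scale0r addr0; apply.
have l_gt0 : 0 < l by rewrite lt_neqAle eq_sym lneq0.
rewrite -ler_pdivrMl//; apply: setdist_ge => c Cc.
rewrite ler_pdivrMl//.
have /setdist_le h : C (p + l *: (c - p)) by apply: starC => //; rewrite l0.
apply: le_trans (h _) _; rewrite !edistE opprD addrACA subrr add0r -scalerBr.
by rewrite vnormZ ger0_norm// subr_sub3.
Qed.

End SetDistance.

(** * Radial maps towards a point are homeomorphisms *)

Section RadialShrinking.
Variables (d : nat) (p : 'rV[R]_d) (mu : 'rV[R]_d -> R) (e C : R).
Hypotheses (e0 : 0 < e) (C_ge0 : 0 <= C) (mu_ge : forall x, e <= mu x).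
Hypothesis mu_lip : forall x y, `|mu x - mu y| <= C * edist x y.
Hypothesis mu_mono : forall l x, 0 <= l <= 1 -> mu (p + l *: (x - p)) <= mu x.

(** The preimage of [a] lies on the ray from [p] through [a]: the point [p + k *: (a - p)] is mapped
    to [a] when [F a k = 1]. *)
Let F (a : 'rV[R]_d) k := k * mu (p + k *: (a - p)).

(** Along a ray from [p] the factor [mu] does not decrease, and it is at least [e]; so [F a] grows
    with slope at least [e]. This gives uniqueness of the solution of [F a k = 1] and its Lipschitz
    dependence on [a]. *)
Let F_gap a k1 k2 : 0 <= k1 -> k1 <= k2 -> e * (k2 - k1) <= F a k2 - F a k1.
Proof.
move=> k10 k12.
have [k20|k20] := eqVneq k2 0.
  have : k1 = 0 by lra.
  by rewrite k20 => ->; rewrite !subrr mulr0.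
have k2_gt0 : 0 < k2 by rewrite lt_neqAle eq_sym k20 (le_trans k10).
have h : mu (p + k1 *: (a - p)) <= mu (p + k2 *: (a - p)).
  have -> : p + k1 *: (a - p) = p + (k1 / k2) *: (p + k2 *: (a - p) - p).
    by rewrite [p + k2 *: _ - p]addrAC subrr add0r scalerA divfK.
  apply: mu_mono; rewrite divr_ge0 ?(ltW k2_gt0)//= ler_pdivrMr// mul1r//.
rewrite /F; set m1 := mu _ in h *; set m2 := mu _ in h *.
have m2e : e <= m2 by exact: mu_ge.
have : k1 * m1 <= k1 * m2 by rewrite ler_wpM2l.
have : (k2 - k1) * e <= (k2 - k1) * m2 by rewrite ler_wpM2l// subr_ge0.
by lra.
Qed.

Let F_gap_abs a k1 k2 : 0 <= k1 -> 0 <= k2 ->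
  e * `|k2 - k1| <= `|F a k2 - F a k1|.
Proof.
move=> k10 k20; have [h|h] := leP k1 k2.
  rewrite ger0_norm ?subr_ge0//; apply: le_trans (F_gap a k10 h) _.
  exact: ler_norm.
rewrite distrC [in X in _ <= X]distrC ger0_norm ?subr_ge0 ?(ltW h)//.
by apply: le_trans (F_gap a k20 (ltW h)) _; exact: ler_norm.
Qed.

Let F_surj a : exists k, [/\ 0 <= k, k <= e^-1 & F a k = 1].
Proof.
have cF : continuous (F a).
  apply: contM; first exact: cont_id.
  apply: (@cont_comp _ _ _ _ mu); last exact: lipschitz_continuous_rV mu_lip.
  by apply: contD; [exact: cont_cst|apply: contZ; [exact: cont_id|exact: cont_cst]].
have ei : 0 <= e^-1 by rewrite invr_ge0 ltW.
have F0 : F a 0 = 0 by rewrite /F mul0r.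
have F1 : 1 <= F a e^-1.
  by rewrite /F ler_pdivlMl// mulr1 mu_ge.
have [|k] := @IVT R (F a) 0 e^-1 1 ei (continuous_subspaceT cF).
  rewrite F0 ge_min ler01/= le_max F1 orbT//.
by rewrite in_itv/= => /andP[k0 k1] Fk; exists k.
Qed.

Lemma radial_shrinking_inverse : exists Hi : 'rV[R]_d -> 'rV[R]_d,
  [/\ cancel (fun x => p + mu x *: (x - p)) Hi,
      cancel Hi (fun x => p + mu x *: (x - p)) & continuous Hi].
Proof.
have [k kP] := choice F_surj.
have mu0 x : 0 < mu x := lt_le_trans e0 (mu_ge x).
exists (fun a => p + k a *: (a - p)); split.
- move=> x; set a := p + mu x *: (x - p).
  have ax : a - p = mu x *: (x - p) by rewrite /a addrAC subrr add0r.
  have [k0 _ Fk] := kP a.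
  suff -> : k a = (mu x)^-1 by rewrite ax scalerA mulVf ?gt_eqF// scale1r addrC subrK.
  have i0 : 0 <= (mu x)^-1 by rewrite invr_ge0 ltW.
  have := F_gap_abs a i0 k0.
  have -> : F a (mu x)^-1 = 1.
    rewrite /F ax scalerA mulVf ?gt_eqF// scale1r [p + _]addrC subrK.
    by rewrite mulVf ?gt_eqF.
  rewrite Fk subrr normr0 pmulr_rle0// normr_le0 subr_eq0.
  by move/eqP.
- move=> a; have [k0 _ Fk] := kP a.
  rewrite [p + k a *: _ - p]addrAC subrr add0r scalerA mulrC -/(F a (k a)) Fk.
  by rewrite scale1r addrC subrK.
(* Compare [F a] at [k a] and [k b], using [F a (k a) = F b (k b)]. One factor [e^-1] comes from the
   slope of [F a], the other two from [k b <= e^-1], which enters twice. *)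
have k_lip : forall a b, `|k a - k b| <= C * (e^-1) ^+ 3 * edist a b.
  move=> a b; have [ka0 ka1 Fa] := kP a; have [kb0 kb1 Fb] := kP b.
  have := F_gap_abs a kb0 ka0; rewrite Fa -{1}Fb /F -mulrBr normrM ger0_norm//.
  have := mu_lip (p + k b *: (b - p)) (p + k b *: (a - p)).
  rewrite [edist (p + _) _]edistE opprD addrACA subrr add0r -scalerBr subr_sub3.
  rewrite vnormZ (ger0_norm kb0) -edistE edistC.
  set q := `|mu _ - mu _| => h1 h2.
  have E0 := edist_ge0 a b.
  have q0 : 0 <= q := normr_ge0 _.
  have h3 : k b * q <= e^-1 * q by rewrite ler_wpM2r.
  have h4 : C * (k b * edist a b) <= C * (e^-1 * edist a b).
    by rewrite ler_wpM2l// ler_wpM2r.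
  rewrite -(ler_pM2l e0); apply: le_trans h2 _; apply: le_trans h3 _.
  have -> : e * (C * e^-1 ^+ 3 * edist a b) = e^-1 * (C * (e^-1 * edist a b)).
    by field; rewrite gt_eqF.
  by rewrite ler_wpM2l ?invr_ge0 ?(ltW e0)// (le_trans h1).
apply: contD; first exact: cont_cst.
apply: contZ; first exact: lipschitz_continuous_rV k_lip.
by apply: contB; [exact: cont_id|exact: cont_cst].
Qed.

End RadialShrinking.

(** * An isotopy that separates a set from a cone it misses *)

Section Unlinking.
Variables (S : set 'rV[R]_3) (g : R -> 'rV[R]_3) (p : 'rV[R]_3).
Hypotheses (cS : compact S) (tS : thick_set S) (cg : closed_curve g).

Let C : set 'rV[R]_3 :=
  [set c | exists s y, [/\ 0 <= s <= 1, range g y & c = p + s *: (y - p)]].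

Hypothesis SC : forall x, S x -> ~ C x.

Let gC t : C (g t).
Proof.
exists 1, (g t); split; [by rewrite ler01 lexx|by exists t|].
by rewrite scale1r addrC subrK.
Qed.

Let pC : C p.
Proof.
by exists 0, (g 0); split; [rewrite ler01 lexx|exists 0|rewrite scale0r addr0].
Qed.

Let C0 : C !=set0. Proof. by exists p; exact: pC. Qed.

Let starC c s : C c -> 0 <= s <= 1 -> C (p + s *: (c - p)).
Proof.
move=> [r [y [/andP[r0 r1] gy ->]]] /andP[s0 s1]; exists (s * r), y; split=> //.
  by rewrite mulr_ge0//= mulr_ile1.
by rewrite [p + r *: _ - p]addrAC subrr add0r scalerA.
Qed.

Let compactC : compact C.
Proof.
have -> : C = (fun q : R * 'rV[R]_3 => p + q.1 *: (q.2 - p)) @`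
    (`[0, 1]%classic `*` range g).
  apply/seteqP; split=> [_ [s [y [s01 gy ->]]]|_ [[s y] [/= s01 gy] <-]].
    by exists (s, y) => //; split=> //=; rewrite in_itv.
  by exists s, y; split=> //; rewrite in_itv in s01.
apply: continuous_compact.
  apply: continuous_subspaceT; apply: contD; first exact: cont_cst.
  apply: contZ; first by move=> q; exact: cvg_fst.
  apply: contB; last exact: cont_cst.
  by move=> q; exact: cvg_snd.
apply: compact_setX; first exact: segment_compact.
exact: compact_closed_curve.
Qed.

(* The cone shrinks radially towards its apex [p], then slides off to infinity
   along a line through [p] that misses [S]. *)
Lemma unlinked_from_cone : separable S (range g).
Proof.
have [eta eta0 etaP] := compact_dist_gt0 cS compactC SC.
have Sp x : S x -> eta <= edist x p by move=> Sx; apply: etaP.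
have cdist : continuous (fun x : 'rV[R]_3 => edist x p).
  by apply: continuous_edist; [exact: cont_id|exact: cont_cst].
have [M _ MP] := compact_upper_bound cS cdist.
have [a [b line]] : exists a b, forall t, ~ S (p + t *: slope_dir a b).
  apply: (@thick_set_generic_line _ S p eta M) => // x Sx.
  by rewrite Sp//= MP.
pose dir : 'rV[R]_3 := slope_dir a b.
have [dir0 dir1 dir2] : [/\ dir ord0 0 = a, dir ord0 1 = b & dir ord0 2 = 1].
  exact: slope_dirE.
(* [m] measures the deviation from the line through [p] along [dir]: it is invariant along [dir],
   homogeneous about [p], and positive on [S]. *)
pose m (x : 'rV[R]_3) : R := `|(x - p) ord0 0 - a * (x - p) ord0 2| +
  `|(x - p) ord0 1 - b * (x - p) ord0 2|.
have cm : continuous m.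
  have cxp i : continuous (fun x : 'rV[R]_3 => (x - p) ord0 i).
    by apply: continuous_coord; apply: contB; [exact: cont_id|exact: cont_cst].
  by apply: contD; apply: cont_norm; apply: contB => //; apply: contM => //;
    exact: cont_cst.
have m_dir x s : m (x + s *: dir) = m x.
  have E i : (x + s *: dir - p) ord0 i = (x - p) ord0 i + s * dir ord0 i.
    by rewrite !mxE; ring.
  have h (u v c : R) : u + s * c - c * (v + s * 1) = u - c * v by ring.
  by rewrite /m !E dir0 dir1 dir2 !h.
have m_scale s v : 0 <= s -> m (p + s *: (v - p)) = s * m v.
  move=> s0; rewrite /m [p + _ - p]addrAC subrr add0r.
  have E i : (s *: (v - p)) ord0 i = s * (v - p) ord0 i by rewrite mxE.
  by rewrite !E ![_ * (s * _)]mulrCA -!mulrBr !normrM (ger0_norm s0) mulrDr.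
have m_gt0 x : S x -> 0 < m x.
  move=> Sx; rewrite lt_def addr_ge0// andbT; apply/eqP => mx0.
  have : `|(x - p) ord0 0 - a * (x - p) ord0 2| = 0 /\
         `|(x - p) ord0 1 - b * (x - p) ord0 2| = 0.
    by split; apply/eqP; rewrite eq_le normr_ge0 andbT -mx0 ?lerDl ?lerDr.
  move=> [/normr0_eq0 e0 /normr0_eq0 e1].
  apply: (line ((x - p) ord0 2)); rewrite -/dir.
  suff -> : p + (x - p) ord0 2 *: dir = x by [].
  rewrite -[RHS](subrK p) addrC; congr (_ + _).
  apply/rowP => i; rewrite [LHS]mxE.
  have [->|->|->] : [\/ i = 0, i = 1 | i = 2].
    by case: i => [[|[|[|//]]] ?]; [constructor 1|constructor 2|constructor 3];
      exact: val_inj.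
  - by rewrite dir0; lra.
  - by rewrite dir1; lra.
  - by rewrite dir2; lra.
have [kap kap0 kapP] := compact_lower_bound cS cm m_gt0.
have cK := compact_closed_curve cg.
have [B B0 BP] := compact_upper_bound cK cm.
have c2 : continuous (fun x : 'rV[R]_3 => `|x ord0 2 - p ord0 2|).
  apply: cont_norm; apply: contB; last exact: cont_cst.
  by apply: continuous_coord; exact: cont_id.
have [B2 B20 B2P] := compact_upper_bound cK c2.
have c2' : continuous (fun x : 'rV[R]_3 => x ord0 2).
  by apply: continuous_coord; exact: cont_id.
have [c0 c00 c0P] := compact_upper_bound cS c2'.
(* After shrinking by [e], the curve has [m <= kap / 2], so [bump] is at least 1/2 on it. *)
pose e := kap / (kap + 2 * B).
have kB : 0 < kap + 2 * B by rewrite ltr_wpDr// mulr_ge0.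
have e_gt0 : 0 < e by rewrite divr_gt0.
have e_le1 : e <= 1 by rewrite ler_pdivrMr// mul1r; lra.
have eB : e * B <= kap / 2.
  rewrite /e mulrAC ler_pdivrMr//.
  have : 0 <= kap * kap by rewrite mulr_ge0// ltW.
  by lra.
(* Sliding by at least [T / 2] lifts the shrunken curve above height [c0 + 1], whereas [S] stays at
   height at most [c0]. *)
pose T := 2 * (c0 + 1 + `|p ord0 2| + B2 + 1).
have T_gt0 : 0 < T.
  by rewrite /T; have := normr_ge0 (p ord0 2); lra.
(* A cutoff equal to 1 on the cone and to 0 at distance at least [eta] from it, hence on [S]. *)
pose phi (x : 'rV[R]_3) : R := Num.max 0 (1 - setdist C x / eta).
have phi0 x : 0 <= phi x by rewrite le_max lexx.
have phi1 x : phi x <= 1.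
  rewrite ge_max ler01/=.
  have : 0 <= setdist C x / eta by rewrite divr_ge0 ?setdist_ge0// ltW.
  by lra.
have phi_lip x y : `|phi x - phi y| <= eta^-1 * edist x y.
  have H u v : phi u - phi v <= eta^-1 * edist u v.
    rewrite lerBlDr ge_max; apply/andP; split.
      by rewrite addr_ge0// mulr_ge0 ?edist_ge0// invr_ge0 ltW.
    have h : 1 - setdist C v / eta <= phi v by rewrite le_max lexx orbT.
    have : `|setdist C u - setdist C v| / eta <= edist u v / eta.
      by rewrite ler_pM2r ?invr_gt0// setdist_lipschitz.
    have : (setdist C v - setdist C u) / eta <= `|setdist C u - setdist C v| / eta.
      by rewrite ler_pM2r ?invr_gt0// distrC ler_norm.
    by lra.
  rewrite ler_norml H andbT lerNl opprB edistC.
  exact: H.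
have cphi : continuous phi by exact: lipschitz_continuous_rV phi_lip.
pose mu (t : R) (x : 'rV[R]_3) : R := 1 - t * (1 - e) * phi x.
(* Zero where [m >= kap], hence on [S]. It is constant along [dir], so the shear is undone by the
   opposite shear. *)
pose bump (x : 'rV[R]_3) : R := Num.max 0 (1 - m x / kap).
have cbump : continuous bump.
  apply: cont_max; first exact: cont_cst.
  apply: contB; first exact: cont_cst.
  by apply: contM => //; exact: cont_cst.
have bump_dir x s : bump (x + s *: dir) = bump x by rewrite /bump m_dir.
pose shrink (t : R) (x : 'rV[R]_3) : 'rV[R]_3 := p + mu t x *: (x - p).
pose shear (t : R) (x : 'rV[R]_3) : 'rV[R]_3 := x + (t * T * bump x) *: dir.
exists (fun t x => shear t (shrink t x)); split; last first.
  exists (delta_mx ord0 2), (c0 + 1).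
  have dot2 x : dotp (delta_mx ord0 2) x = x ord0 2.
    rewrite /dotp (bigD1 2)//= big1 ?addr0; first by rewrite mxE !eqxx mul1r.
    by move=> i i2; rewrite mxE (negbTE i2) andbF mul0r.
  split=> x Hx; rewrite dot2.
    have phix : phi x = 0.
      apply/eqP; rewrite eq_le phi0 andbT ge_max lexx/= subr_le0.
      by rewrite ler_pdivlMr// mul1r setdist_ge// => c; exact: etaP.
    have bx : bump x = 0.
      apply/eqP; rewrite eq_le [0 <= _]le_max lexx andbT ge_max lexx/= subr_le0.
      by rewrite ler_pdivlMr// mul1r kapP.
    rewrite /shear /shrink /mu phix mulr0 subr0 scale1r.
    rewrite [p + (x - p)]addrC subrK bx mulr0 scale0r addr0.
    by have := c0P _ Hx; lra.
  have [t _ xE] := Hx.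
  have phix : phi x = 1.
    rewrite /phi (setdist_eq0 C0); last by rewrite -xE; exact: gC.
    by rewrite mul0r subr0; apply/max_idPr; exact: ler01.
  have shE : shrink 1 x = p + e *: (x - p).
    by rewrite /shrink /mu phix; congr (_ + _ *: _); ring.
  rewrite /shear shE.
  have bx : 1 / 2 <= bump (p + e *: (x - p)).
    rewrite le_max; apply/orP; right; rewrite m_scale ?(ltW e_gt0)//.
    have : e * m x / kap <= 1 / 2.
      rewrite ler_pdivrMr//.
      have : e * m x <= e * B by rewrite ler_wpM2l ?(ltW e_gt0)// BP.
      by lra.
    by lra.
  set bu := bump _ in bx *.
  have -> : (p + e *: (x - p) + (1 * T * bu) *: dir) ord0 2 =
      p ord0 2 + e * (x ord0 2 - p ord0 2) + T * bu.
    have d2 := dir2; rewrite !mxE; rewrite !mxE in d2; rewrite d2; ring.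
  have h1 : T * (1 / 2) <= T * bu by rewrite ler_pM2l.
  have h2 : `|e * (x ord0 2 - p ord0 2)| <= B2.
    rewrite normrM (ger0_norm (ltW e_gt0)).
    apply: (@le_trans _ _ (1 * B2)); last by rewrite mul1r.
    by apply: ler_pM; rewrite ?(ltW e_gt0)// B2P.
  have h3 := ler_norm (- (e * (x ord0 2 - p ord0 2))).
  have h4 := ler_norm (- p ord0 2).
  rewrite !normrN in h3 h4.
  by move: h1; rewrite /T; lra.
split.
  have csh : continuous (fun q : R * 'rV[R]_3 => shrink q.1 q.2).
    apply: contD; first exact: cont_cst.
    apply: contZ; last first.
      by apply: contB; [move=> q; exact: cvg_snd|exact: cont_cst].
    apply: contB; first exact: cont_cst.
    apply: contM.
      by apply: contM; [move=> q; exact: cvg_fst|exact: cont_cst].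
    by apply: (@cont_comp _ _ _ _ phi) => // q; exact: cvg_snd.
  apply: contD => //.
  apply: contZ; last exact: cont_cst.
  apply: contM; first by apply: contM; [move=> q; exact: cvg_fst|exact: cont_cst].
  exact: (@cont_comp _ _ _ _ bump).
split.
  apply: funext => x; rewrite /shear /shrink /mu !mul0r subr0 scale1r.
  by rewrite scale0r addr0 addrC subrK.
move=> t /andP[t0 t1].
have te : 0 <= t * (1 - e) by rewrite mulr_ge0// subr_ge0.
have te1 : t * (1 - e) <= 1 - e by rewrite ler_piMl// subr_ge0.
have mu_ge x : e <= mu t x.
  have : t * (1 - e) * phi x <= t * (1 - e) by rewrite ler_piMr.
  by rewrite /mu; lra.
have mu_lip x y : `|mu t x - mu t y| <= t * (1 - e) * eta^-1 * edist x y.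
  have -> : mu t x - mu t y = t * (1 - e) * (phi y - phi x) by rewrite /mu; ring.
  by rewrite normrM (ger0_norm te) distrC -[X in _ <= X]mulrA ler_wpM2l.
(* The cone is star-shaped about [p]: moving towards [p] does not increase the distance to it, so
   [phi] does not decrease. *)
have mu_mono l x : 0 <= l <= 1 -> mu t (p + l *: (x - p)) <= mu t x.
  move=> l01; rewrite /mu lerD2l lerN2 ler_wpM2l//.
  rewrite ge_max phi0/= le_max; apply/orP; right.
  rewrite lerD2l lerN2 ler_pM2r ?invr_gt0//.
  apply: le_trans (setdist_star C0 _ starC l01) _.
  by case/andP: l01 => l0 l1; rewrite ler_piMl ?setdist_ge0.
have K0 : 0 <= t * (1 - e) * eta^-1 by rewrite mulr_ge0// invr_ge0 ltW.
have [Hi [HiK KHi cHi]] := radial_shrinking_inverse e_gt0 K0 mu_ge mu_lip mu_mono.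
exists (fun x : 'rV[R]_3 => Hi (x - (t * T * bump x) *: dir)).
have cshear (s : R) : continuous (fun x : 'rV[R]_3 => x + (s * T * bump x) *: dir).
  apply: contD; first exact: cont_id.
  by apply: contZ; [apply: contM => //; exact: cont_cst|exact: cont_cst].
split; [|split; [|split]].
- move=> x; rewrite /shear bump_dir addrK; exact: HiK.
- move=> x; rewrite /shear -scaleNr /shrink KHi bump_dir scaleNr subrK//.
- apply: (@cont_comp _ _ _ (shrink t) (shear t)); last exact: cshear.
  apply: contD; first exact: cont_cst.
  apply: contZ; last by apply: contB; [exact: cont_id|exact: cont_cst].
  by apply: contB; [exact: cont_cst|apply: contM => //; exact: cont_cst].
- apply: (@cont_comp _ _ _ _ Hi) => //.
  apply: contB; first exact: cont_id.
  by apply: contZ; [apply: contM => //; exact: cont_cst|exact: cont_cst].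
Qed.

End Unlinking.

Lemma linked_meets_cone (S : set 'rV[R]_3) (g : R -> 'rV[R]_3) (p : 'rV[R]_3) :
  compact S -> thick_set S -> closed_curve g ->
  topologically_linked S (range g) ->
  exists s t, [/\ 0 <= s <= 1, 0 <= t < 1 & S (p + s *: (g t - p))].
Proof.
move=> cS tS cg linked; apply: contrapT => H; apply: linked.
apply: (unlinked_from_cone (p := p)) => // x Sx [s [y [s01 gy xE]]]; apply: H.
have [t t01 gt] := closed_curve_param cg gy.
by exists s, t; rewrite gt -xE.
Qed.

End Separation.

(** * Cones with angle 2 pi and their development *)

Section Angles.
Variable R : realType.

(** A modulus of continuity for [acos] that remains valid at the endpoints -1 and 1. With [a] half
    of [acos x] and [d] half of the difference of the angles, [x - y - (1 - cos (2 d))] equals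
    [4 sin a sin d cos (a + d)], which is nonnegative. *)
Lemma cos_dist_acos (x y : R) : -1 <= x <= 1 -> -1 <= y <= 1 ->
  1 - `|x - y| <= cos (acos x - acos y).
Proof.
wlog : x y / acos x <= acos y.
  move=> H hx hy; have [h|h] := leP (acos x) (acos y); first exact: H.
  by rewrite distrC -cosN opprB H// ltW.
move=> xy hx hy.
have a0 := acos_ge0 hx; have b1 := acos_lepi hy.
have cx : cos (acos x) = x by rewrite acosK// in_itv.
have cy : cos (acos y) = y by rewrite acosK// in_itv.
pose a := acos x / 2; pose d := (acos y - acos x) / 2.
have ax : acos x = a *+ 2 by rewrite /a; lra.
have ay : acos y = (a + d) *+ 2 by rewrite /a /d; lra.
have pi0 := @pi_gt0 R.
have ca : 0 <= cos (a + d).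
  by apply: cos_ge0_pihalf; apply/andP; rewrite /a /d; split; lra.
have sa : 0 <= sin a by apply: sin_ge0_pi; apply/andP; rewrite /a; split; lra.
have sd : 0 <= sin d by apply: sin_ge0_pi; apply/andP; rewrite /d; split; lra.
have -> : acos x - acos y = - (d *+ 2) by rewrite /d; lra.
rewrite cosN.
have : 1 - cos (d *+ 2) <= x - y.
  rewrite -cx -cy ax ay !cos_mulr2n; rewrite cosD in ca *.
  have := sin2cos2 a; have := sin2cos2 d.
  have := mulr_ge0 (mulr_ge0 sa sd) ca.
  set sA := sin a; set sD := sin d; set cA := cos a; set cD := cos d => H e1 e2.
  have : (cA * cD - sA * sD) ^+ 2 =
      cA ^+ 2 * cD ^+ 2 - 2 * (sA * sD * (cA * cD - sA * sD)) - sA ^+ 2 * sD ^+ 2.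
    by ring.
  move=> ->; rewrite e1 e2; lra.
by have := ler_norm (x - y); lra.
Qed.

Lemma cont_acos (T : topologicalType) (f : T -> R) :
  continuous f -> (forall x, -1 <= f x <= 1) -> continuous (fun x => acos (f x)).
Proof.
move=> cf f1 x; apply/cvgrPdist_le => e0 e0_gt0.
pose e := Num.min e0 pi.
have e_gt0 : 0 < e by rewrite lt_min e0_gt0 pi_gt0.
have e_pi : e <= pi by rewrite ge_min lexx orbT.
have ce : 0 < 1 - cos e.
  rewrite subr_gt0 -cos0 ltr_cos ?in_itv/= ?lexx ?pi_ge0 ?e_pi ?andbT//; exact: ltW.
move/cvgrPdist_lt: (cf x) => /(_ _ ce); apply: filterS => y h.
have := cos_dist_acos (f1 x) (f1 y).
set D := acos (f x) - acos (f y) => H.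
have {}H : cos e < cos `|D| by rewrite cos_norm; lra.
have Dpi : `|D| <= pi.
  have /acos_ge0 := f1 x; have /acos_lepi := f1 x.
  have /acos_ge0 := f1 y; have /acos_lepi := f1 y.
  by rewrite /D ler_norml => ????; apply/andP; split; lra.
rewrite ltr_cos ?in_itv/= ?e_pi ?(ltW e_gt0) ?Dpi ?normr_ge0// in H.
by apply: le_trans (ltW H) _; rewrite ge_min lexx.
Qed.

Variable d : nat.
Implicit Types u v w : 'rV[R]_d.

Definition unitv u := (vnorm u)^-1 *: u.

Lemma unitv_norm u : u != 0 -> dotp (unitv u) (unitv u) = 1.
Proof.
move=> u0; rewrite /unitv !dotpE -sqr_vnorm.
by field; rewrite vnorm_eq0.
Qed.

Lemma unitvZ a u : 0 < a -> unitv (a *: u) = unitv u.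
Proof.
move=> a0; rewrite /unitv vnormZ gtr0_norm// scalerA invfM mulrAC mulVf ?mul1r//.
by rewrite gt_eqF.
Qed.

Lemma unitvN u : unitv (- u) = - unitv u.
Proof. by rewrite /unitv vnormN scalerN. Qed.

Lemma dotp_unitv_itv u v : u != 0 -> v != 0 -> -1 <= dotp (unitv u) (unitv v) <= 1.
Proof.
move=> u0 v0; rewrite -ler_norml.
by apply: le_trans (cauchy_schwarz_abs _ _) _; rewrite /vnorm !unitv_norm// sqrtr1 mulr1.
Qed.

Definition ang u v : R := acos (dotp (unitv u) (unitv v)).

Lemma angC u v : ang u v = ang v u. Proof. by rewrite /ang dotpC. Qed.

Lemma ang_ge0 u v : u != 0 -> v != 0 -> 0 <= ang u v.
Proof. by move=> u0 v0; apply: acos_ge0; exact: dotp_unitv_itv. Qed.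

Lemma ang_lepi u v : u != 0 -> v != 0 -> ang u v <= pi.
Proof. by move=> u0 v0; apply: acos_lepi; exact: dotp_unitv_itv. Qed.

Lemma cos_ang u v : u != 0 -> v != 0 -> cos (ang u v) = dotp (unitv u) (unitv v).
Proof. by move=> u0 v0; rewrite acosK// in_itv/= dotp_unitv_itv. Qed.

Lemma dotp_cos_ang u v : u != 0 -> v != 0 ->
  dotp u v = vnorm u * vnorm v * cos (ang u v).
Proof.
move=> u0 v0; rewrite cos_ang// /unitv !dotpE.
by field; rewrite !vnorm_eq0 u0 v0.
Qed.

Lemma ang_xx u : u != 0 -> ang u u = 0.
Proof. by move=> u0; rewrite /ang unitv_norm// acos1. Qed.

Lemma angNr u : u != 0 -> ang u (- u) = pi.
Proof. by move=> u0; rewrite /ang unitvN dotpNr unitv_norm// acosN1. Qed.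

Lemma angZ a b u v : 0 < a -> 0 < b -> ang (a *: u) (b *: v) = ang u v.
Proof. by move=> a0 b0; rewrite /ang !unitvZ. Qed.

(** Spherical triangle inequality: Cauchy-Schwarz for the components of the unit vectors [u] and [w]
    orthogonal to [v] bounds their scalar product below by the cosine of the sum of the angles. *)
Lemma ang_triangle u v w : u != 0 -> v != 0 -> w != 0 ->
  ang u w <= ang u v + ang v w.
Proof.
move=> u0 v0 w0.
have [h|h] := leP pi (ang u v + ang v w); first exact: le_trans (ang_lepi u0 w0) h.
rewrite leNgt -ltr_cos ?in_itv/= ?ang_ge0 ?ang_lepi ?addr_ge0 ?ang_ge0 ?(ltW h)//.
rewrite -leNgt cosD !cos_ang// /ang !sin_acos ?dotp_unitv_itv//.
have uu := unitv_norm u0; have vv := unitv_norm v0; have ww := unitv_norm w0.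
move: (unitv u) (unitv v) (unitv w) uu vv ww => {u v w u0 v0 w0 h} u v w uu vv ww.
have := cauchy_schwarz_abs (u - dotp u v *: v) (w - dotp v w *: v).
rewrite /vnorm !dotpE uu vv ww [dotp v u]dotpC [dotp w v]dotpC.
have E (a b c : R) : c - b * a - (a * b - a * (b * 1)) = c - a * b by ring.
have E1 (a : R) : 1 - a * a - (a * a - a * (a * 1)) = 1 - a ^+ 2 by ring.
rewrite ler_norml => /andP[H _]; move: H.
set x := dotp u v; set y := dotp v w.
set X := (X in Num.sqrt X * _); set Y := (X in _ * Num.sqrt X).
have -> : X = 1 - x ^+ 2 by rewrite /X -/x; ring.
have -> : Y = 1 - y ^+ 2 by rewrite /Y -/y; ring.
by set s := Num.sqrt _ * _; lra.
Qed.

Lemma ang_sum (v : nat -> 'rV[R]_d) i n : (forall j, v j != 0) ->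
  ang (v i) (v (i + n)%N) <= \sum_(l < n) ang (v (i + l)%N) (v (i + l).+1).
Proof.
move=> v0; elim: n => [|n IH]; first by rewrite addn0 ang_xx// big_ord0.
rewrite big_ord_recr/= addnS; apply: le_trans (ang_triangle (v0 i) (v0 (i + n)%N) (v0 _)) _.
by rewrite lerD2r.
Qed.

Lemma cont_ang (T : topologicalType) (f g : T -> 'rV[R]_d) :
  continuous f -> continuous g -> (forall x, f x != 0) -> (forall x, g x != 0) ->
  continuous (fun x => ang (f x) (g x)).
Proof.
move=> cf cg f0 g0; apply: cont_acos => [|x]; last exact: dotp_unitv_itv.
have cu (h : T -> 'rV[R]_d) : continuous h -> (forall x, h x != 0) ->
    continuous (fun x => unitv (h x)).
  move=> ch h0; apply: contZ => // x.
  apply: cvgV; first by rewrite vnorm_eq0.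
  exact: continuous_vnorm.
by apply: continuous_dotp; exact: cu.
Qed.

End Angles.

(** * An apex with cone angle 2 pi *)

Section ConeApex.
Variable R : realType.

Lemma avoid_finitely_many (N : nat) (b : nat -> R) :
  exists s, 0 < s < 1 /\ forall i, (i < N)%N -> s != b i.
Proof.
apply: contrapT => H.
pose s (j : 'I_N.+1) : R := (j.+2)%:R^-1.
have s01 j : 0 < s j < 1.
  by rewrite invr_gt0 ltr0n/= invf_lt1 ?ltr0n// ltr1n.
have bad j : exists i : 'I_N, s j = b i.
  apply: contrapT => nb; apply: H; exists (s j); split=> // i iN.
  by apply/eqP => sb; apply: nb; exists (Ordinal iN).
have [f fP] := choice bad.
have : injective f.
  move=> j k fjk; have : s j = s k by rewrite !fP fjk.
  by move=> /invr_inj/eqP; rewrite eqr_nat => /eqP[] /val_inj.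
by move=> /leq_card; rewrite !card_ord ltnn.
Qed.

Definition cone_angle d (v : nat -> 'rV[R]_d) (N : nat) (p : 'rV[R]_d) : R :=
  \sum_(i < N) ang (v i - p) (v i.+1 - p).

(* The cone angle is at least [2 * pi] at a point of an edge and tends to 0 at
   infinity; as a function of the apex it is continuous away from the vertices. *)
Lemma cone_apex_exists (v : nat -> 'rV[R]_3) (N : nat) :
  (forall i, v (i + N)%N = v i) -> (1 < N)%N -> v 0 != v 1 ->
  exists p, (forall i, v i != p) /\ cone_angle v N p = 2 * pi.
Proof.
move=> per N1 v01.
have modN i : v i = v (i %% N)%N.
  rewrite {1}(divn_eq i N); elim: (i %/ N)%N => [//|k IH].
  by rewrite mulSn -addnA addnC per.
have ltN i : (i %% N < N)%N by rewrite ltn_mod ltnW.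
pose e := v 1 - v 0.
have e0 : e != 0 by rewrite subr_eq0 eq_sym.
(* The starting apex [p0] is a point of the first edge that is not a vertex. *)
have [l [/andP[l0 l1] lP]] := avoid_finitely_many N
  (fun i => dotp (v i - v 0) e / dotp e e).
pose p0 := v 0 + l *: e.
have vp0 i : v i != p0.
  rewrite modN; apply: contra_neq (lP _ (ltN i)) => ->.
  by rewrite /p0 [v 0 + _]addrC addrK dotpZl mulfK// dotp_eq0.
pose x i := v i - p0.
(* The slope [s] is chosen so that the ray from [p0] along [w] passes through no vertex. *)
have [s [_ sP]] := avoid_finitely_many N (fun i => x i ord0 1 / x i ord0 0).
pose w : 'rV[R]_3 := \row_(i < 3) [:: 1; s; 0]`_i.
have w0 : w ord0 0 = 1 by rewrite mxE.
have w1 : w ord0 1 = s by rewrite mxE.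
have w_neq0 : w != 0.
  by apply/eqP => /rowP/(_ 0); rewrite w0 mxE => /eqP; rewrite oner_eq0.
(* For the apex [p0 + t / (1 - t) *: w] this is [v i] minus the apex, rescaled by [1 - t]. Angles
   ignore the scale, and [t = 1] becomes the apex at infinity, where all the vectors coincide. *)
pose A i t := (1 - t) *: x i - t *: w.
have A_neq0 i t : 0 <= t <= 1 -> A i t != 0.
  move=> /andP[t0 t1]; apply/eqP => A0.
  have [t_eq1|t_neq1] := eqVneq t 1.
    move/eqP: A0; rewrite /A t_eq1 subrr scale0r sub0r scale1r oppr_eq0.
    by rewrite (negbTE w_neq0).
  have [t_eq0|t_neq0] := eqVneq t 0.
    move/eqP: A0; rewrite /A t_eq0 subr0 scale0r subr0 scale1r subr_eq0.
    by rewrite (negbTE (vp0 i)).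
  have [c0 c1] : (1 - t) * x (i %% N)%N ord0 0 = t /\
      (1 - t) * x (i %% N)%N ord0 1 = t * s.
    rewrite /x -modN -/(x i).
    move/eqP: A0; rewrite subr_eq0 => /eqP/rowP A0.
    have := A0 0; have := A0 1; rewrite [LHS]mxE [in RHS]mxE w1 => ->.
    by rewrite [LHS]mxE [in RHS]mxE w0 mulr1 => ->.
  have t1' : 1 - t != 0 by rewrite subr_eq0 eq_sym.
  have xx0 : x (i %% N)%N ord0 0 != 0.
    by apply: contra_neq t_neq0 => h; rewrite -c0 h mulr0.
  have /negP[] := sP _ (ltN i); apply/eqP.
  apply: (mulIf xx0); rewrite divfK//; apply: (mulfI t1'); rewrite c1 mulrCA c0.
  exact: mulrC.
pose cl t : R := Num.max 0 (Num.min 1 t).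
have cl01 t : 0 <= cl t <= 1.
  by rewrite le_max lexx/= ge_max ler01/= ge_min lexx.
have clE t : 0 <= t <= 1 -> cl t = t.
  by move=> /andP[t0 t1]; rewrite /cl (min_idPr t1); apply/max_idPr.
have ccl : continuous cl.
  apply: cont_max; first exact: cont_cst.
  by apply: cont_min; [exact: cont_cst|exact: cont_id].
have cA i : continuous (fun t => A i (cl t)).
  apply: contB; apply: contZ => //; try exact: cont_cst.
  by apply: contB => //; exact: cont_cst.
pose Th t := \sum_(i < N) ang (A i (cl t)) (A i.+1 (cl t)).
have cTh : continuous Th.
  apply: continuous_sumr => i; apply: cont_ang => // t; exact: A_neq0.
(* From [p0] the first edge is seen under angle [pi]; the rest of the polygon returns between the
   same opposite directions and contributes at least [pi] more. *)
have Th0 : 2 * pi <= Th 0.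
  have A0 i : A i (cl 0) = x i.
    by rewrite clE ?lexx ?ler01// /A subr0 scale1r scale0r subr0.
  have x0 i : x i != 0 by rewrite subr_eq0.
  rewrite /Th; under eq_bigr do rewrite !A0.
  have a01 : ang (x 0) (x 1) = pi.
    have -> : x 0 = l *: - e.
      by rewrite /x /p0 opprD addrA subrr sub0r scalerN.
    have -> : x 1 = (1 - l) *: e.
      by rewrite scalerBl scale1r /x /p0 opprD addrA.
    by rewrite angZ ?subr_gt0// angC angNr.
  case: N N1 per {modN lP sP ltN Th cTh} => [//|N] _ per.
  rewrite big_ord_recl/= a01.
  have := @ang_sum _ _ x 1 N x0.
  have -> : x (1 + N)%N = x 0 by rewrite /x -(per 0) add0n.
  by rewrite angC a01 => h; rewrite mulr2n mulrDl mul1r lerD2l.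
have Th1 : Th 1 = 0.
  rewrite /Th big1// => i _.
  by rewrite clE ?lexx ?ler01// /A subrr !scale0r !sub0r scale1r ang_xx// oppr_eq0.
have pi0 := @pi_gt0 R.
have [|t] := @IVT R Th 0 1 (2 * pi) ler01 (continuous_subspaceT cTh).
  by rewrite Th1 ge_min le_max Th0/= mulr_ge0 ?pi_ge0 ?orbT.
rewrite in_itv/= => t01 Tht.
have t_lt1 : 0 < 1 - t.
  rewrite subr_gt0 lt_neqAle; case/andP: (t01) => _ ->; rewrite andbT.
  by apply/eqP => t1; move: Tht; rewrite t1 Th1; lra.
pose p := p0 + (t / (1 - t)) *: w.
have vp i : v i - p = (1 - t)^-1 *: A i t.
  rewrite /A scalerBr !scalerA mulVf ?gt_eqF// scale1r /p /x opprD addrA.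
  by rewrite [t / _]mulrC.
have it : 0 < (1 - t)^-1 by rewrite invr_gt0.
exists p; split=> [i|].
  by rewrite -subr_eq0 vp scaler_eq0 negb_or A_neq0// andbT gt_eqF.
rewrite -Tht; apply: eq_bigr => i _.
by rewrite !vp angZ// clE.
Qed.

End ConeApex.

(** * A ray inside a turning polygon meets an edge *)

Section RayCrossing.
Variable R : realType.

Lemma sin_le0_piN (x : R) : - pi <= x <= 0 -> sin x <= 0.
Proof.
by move=> /andP[h1 h2]; rewrite -oppr_ge0 -sinN sin_ge0_pi//; apply/andP; split; lra.
Qed.

Lemma angle_representative (b c : R) :
  exists b', [/\ c - pi <= b' <= c + pi, cos b' = cos b & sin b' = sin b].
Proof.
have pi0 := @pi_gt0 R.
have pi2 : 0 < pi *+ 2 :> R by lra.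
pose k := Num.floor ((b - c + pi) / (pi *+ 2)).
have hk : k%:~R * (pi *+ 2) <= b - c + pi < (k%:~R + 1) * (pi *+ 2).
  rewrite -ler_pdivlMr// -ltr_pdivrMr// -[1]/(1%:~R) -intrD.
  by rewrite floor_le_tmp floorD1_gt.
have per (f : R -> R) :
    periodic f (pi *+ 2) -> f (b - k%:~R * (pi *+ 2)) = f b.
  move=> pf; case: (k) => n.
    rewrite [_%:~R * _]mulr_natl -[in RHS](subrK ((pi *+ 2) *+ n) b).
    by rewrite (periodicn pf).
  by rewrite NegzE mulrNz mulNr opprK mulr_natl (periodicn pf).
exists (b - k%:~R * (pi *+ 2)).
split; first by case/andP: hk => h1 h2; apply/andP; split; lra.
- exact: per (@cosD2pi R).
- exact: per (@sinD2pi R).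
Qed.

Variables (r th : nat -> R).
Hypotheses (r_gt0 : forall i, 0 < r i)
  (th_incr : forall i, 0 <= th i.+1 - th i <= pi).

Let th_mono i j : (i <= j)%N -> th i <= th j.
Proof.
elim: j => [|j IH]; first by rewrite leqn0 => /eqP->.
rewrite leq_eqVlt => /orP[/eqP->//|]; rewrite ltnS => /IH h.
by case/andP: (th_incr j) => h1 _; lra.
Qed.

(* A ray leaving the point [s w_0] of the spoke [0 w_0] meets the polygon with
   vertices [w_i = r_i (cos th_i, sin th_i)]. *)
Lemma ray_crossing (s b : R) :
  0 <= s <= 1 -> th 0%N <= b <= th 0%N + pi -> (exists l, b <= th l) ->
  exists i l t, [/\ 0 <= l <= 1, 0 <= t,
    (1 - l) * (r i * cos (th i)) + l * (r i.+1 * cos (th i.+1)) =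
      s * (r 0%N * cos (th 0%N)) + t * cos b &
    (1 - l) * (r i * sin (th i)) + l * (r i.+1 * sin (th i.+1)) =
      s * (r 0%N * sin (th 0%N)) + t * sin b].
Proof.
move=> /andP[s0 s1] /andP[b0 b1] exl.
have pi0 := @pi_gt0 R.
case: (ex_minnP exl) => [[|k]] bl l_min.
  have -> : b = th 0%N by lra.
  exists 0%N, 0, ((1 - s) * r 0%N); rewrite lexx ler01; split=> //.
  - by rewrite mulr_ge0 ?subr_ge0// ltW.
  - ring.
  - ring.
have thk : th k < b.
  by rewrite ltNge; apply/negP => /l_min; rewrite ltnn.
(* Here vertex [k.+1] lies exactly opposite to spoke [0], on the ray itself. Set apart because the
   crossing below needs [b < th i + pi]. *)
have [/andP[/eqP thk0 /eqP b_eq]|nspecial] :=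
    boolP ((th k == th 0%N) && (b == th 0%N + pi)).
  have thk1 : th k.+1 = b by case/andP: (th_incr k) => _ h; lra.
  exists k, 1, (r k.+1 + s * r 0%N); rewrite lexx ler01; split=> //.
  - by rewrite addr_ge0 ?mulr_ge0// ltW.
  - by rewrite thk1 b_eq cosDpi; ring.
  - by rewrite thk1 b_eq sinDpi; ring.
(* Signed distance of vertex [i] from the line carrying the ray; a change of sign along an edge is a
   crossing of that line. *)
pose f i := r i * sin (th i - b) - s * (r 0%N * sin (th 0%N - b)).
have sin0b : sin (th 0%N - b) <= 0.
  by apply: sin_le0_piN; apply/andP; split; lra.
have srb : s * (r 0%N * sin (th 0%N - b)) <= 0.
  by rewrite mulr_ge0_le0// mulr_ge0_le0// ltW.
have fk1 : 0 <= f k.+1.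
  rewrite subr_ge0; apply: le_trans srb _; rewrite mulr_ge0 ?(ltW (r_gt0 _))//.
  by apply: sin_ge0_pi; case/andP: (th_incr k) => _ h; apply/andP; split; lra.
have f0 : f 0%N <= 0.
  have -> : f 0%N = (1 - s) * (r 0%N * sin (th 0%N - b)) by rewrite /f; ring.
  by rewrite mulr_ge0_le0 ?subr_ge0// mulr_ge0_le0// ltW.
(* The bounds [th i < b < th i + pi] select a crossing on the ray and not on its backward extension.
   Take [i = k] if [b] is opposite to spoke [0], and otherwise the first change of sign. *)
have [i [fi fi1 thi thi' bi]] :
    exists i, [/\ f i <= 0, 0 <= f i.+1, th 0%N <= th i, th i < b & b < th i + pi].
  have [b_eq|b_neq] := eqVneq b (th 0%N + pi).
    have thk0 : th 0%N < th k.
      by rewrite lt_neqAle th_mono// andbT eq_sym; move: nspecial; rewrite b_eq eqxx andbT.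
    exists k; split=> //; [|exact: ltW|lra].
    have -> : f k = r k * sin (th k - b).
      have e : th 0%N - b = - pi by lra.
      by rewrite /f e sinN sinpi oppr0 !mulr0 subr0.
    rewrite mulr_ge0_le0 ?(ltW (r_gt0 _))//; apply: sin_le0_piN; apply/andP; split; lra.
  have exi : exists i, 0 <= f i.+1 by exists k.
  case: (ex_minnP exi) => i fi1 i_min.
  have ik : (i <= k)%N by exact: i_min.
  have thik := th_mono ik; have th0i := th_mono (leq0n i).
  have b_lt : b < th 0%N + pi by rewrite lt_neqAle b_neq.
  exists i; split=> //; [|lra|lra].
  case: i fi1 i_min {ik thik th0i} => [//|i] _ i_min.
  by rewrite leNgt; apply/negP => /ltW/i_min; rewrite ltnn.
have [l [l01 fl]] : exists l, 0 <= l <= 1 /\ (1 - l) * f i + l * f i.+1 = 0.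
  have [fii|fii] := eqVneq (f i.+1) (f i).
    by exists 0; rewrite lexx ler01; split=> //; rewrite subr0 mul1r mul0r addr0; lra.
  have fp : 0 < f i.+1 - f i by rewrite subr_gt0 lt_neqAle eq_sym fii; lra.
  exists (- f i / (f i.+1 - f i)); split.
    by rewrite divr_ge0 ?oppr_ge0 ?(ltW fp)//= ler_pdivrMr// mul1r; lra.
  by field; rewrite gt_eqF.
have /andP[l0 l1] := l01.
pose X := (1 - l) * (r i * cos (th i)) + l * (r i.+1 * cos (th i.+1))
  - s * (r 0%N * cos (th 0%N)).
pose Y := (1 - l) * (r i * sin (th i)) + l * (r i.+1 * sin (th i.+1))
  - s * (r 0%N * sin (th 0%N)).
have XY : X * sin b = Y * cos b.
  by move: fl; rewrite /f !sinB /X /Y; lra.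
pose t := X * cos b + Y * sin b.
have cs := cos2Dsin2 b.
have Xt : X = t * cos b.
  have -> : t * cos b = X * cos b ^+ 2 + sin b * (Y * cos b) by rewrite /t; ring.
  rewrite -XY; have -> : X * cos b ^+ 2 + sin b * (X * sin b) =
    X * (cos b ^+ 2 + sin b ^+ 2) by ring.
  by rewrite cs mulr1.
have Yt : Y = t * sin b.
  have -> : t * sin b = (X * sin b) * cos b + Y * sin b ^+ 2 by rewrite /t; ring.
  rewrite XY; have -> : Y * cos b * cos b + Y * sin b ^+ 2 =
    Y * (cos b ^+ 2 + sin b ^+ 2) by ring.
  by rewrite cs mulr1.
exists i, l, t; split=> //; [|by rewrite -Xt /X; lra|by rewrite -Yt /Y; lra].
have sbi : 0 < sin (b - th i) by apply: sin_gt0_pi; apply/andP; split; lra.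
(* The crossing equation projected orthogonally to spoke [i]; both terms on the right have the sign
   that makes [t] nonnegative. *)
have E : t * sin (b - th i) = l * (r i.+1 * sin (th i.+1 - th i))
    - s * (r 0%N * sin (th 0%N - th i)).
  have -> : t * sin (b - th i) = Y * cos (th i) - X * sin (th i).
    by rewrite Xt Yt sinB; ring.
  by rewrite /X /Y !sinB; ring.
rewrite -(pmulr_lge0 _ sbi) E subr_ge0; apply: (@le_trans _ _ 0).
  rewrite mulr_ge0_le0// mulr_ge0_le0 ?(ltW (r_gt0 _))//.
  by apply: sin_le0_piN; apply/andP; split; lra.
by rewrite !mulr_ge0 ?(ltW (r_gt0 _))// sin_ge0_pi.
Qed.

End RayCrossing.

(** * Development of the cone in polar coordinates *)

Section PlanarDevelopment.
Variable R : realType.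

Definition polar (r t : R) : 'rV[R]_2 := \row_(i < 2) [:: r * cos t; r * sin t]`_i.

Lemma polar0 r t : polar r t ord0 0 = r * cos t. Proof. by rewrite mxE. Qed.

Lemma polar1 r t : polar r t ord0 1 = r * sin t. Proof. by rewrite mxE. Qed.

Lemma row2P (x y : 'rV[R]_2) :
  x ord0 0 = y ord0 0 -> x ord0 1 = y ord0 1 -> x = y.
Proof.
move=> h0 h1; apply/rowP => i.
suff [->|->] : i = 0 \/ i = 1 by [].
by case: i => [[|[|//]] ?]; [left|right]; exact: val_inj.
Qed.

Lemma dotp2 (x y : 'rV[R]_2) :
  dotp x y = x ord0 0 * y ord0 0 + x ord0 1 * y ord0 1.
Proof.
rewrite /dotp !big_ord_recl big_ord0 addr0.
by congr (x _ _ * y _ _ + x _ _ * y _ _); exact: val_inj.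
Qed.

Lemma dotp_polar r t r' t' : dotp (polar r t) (polar r' t') = r * r' * cos (t - t').
Proof. by rewrite dotp2 !polar0 !polar1 cosB; ring. Qed.

Lemma polarZ a r t : a *: polar r t = polar (a * r) t.
Proof. by apply: row2P; rewrite [LHS]mxE ?polar0 ?polar1 mulrA. Qed.

Variables (v : nat -> 'rV[R]_3) (N : nat) (p : 'rV[R]_3).
Hypotheses (v_per : forall i, v (i + N)%N = v i) (vp : forall i, v i != p)
  (angle2pi : cone_angle v N p = 2 * pi).

Let x i := v i - p.
Let x0 i : x i != 0. Proof. by rewrite subr_eq0. Qed.
Let x_per i : x (i + N)%N = x i. Proof. by rewrite /x v_per. Qed.
Let r i := vnorm (x i).
Let r_gt0 i : 0 < r i. Proof. by rewrite vnorm_gt0. Qed.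
Let th i := \sum_(l < i) ang (x l) (x l.+1).

Let thS i : th i.+1 = th i + ang (x i) (x i.+1).
Proof. by rewrite /th big_ord_recr. Qed.

Let th_per i : th (i + N)%N = th i + 2 * pi.
Proof.
elim: i => [|i IH]; last first.
  by rewrite addSn !thS IH -addSn !x_per; ring.
by rewrite add0n {2}/th big_ord0 add0r -angle2pi.
Qed.

Let th_incr i : 0 <= th i.+1 - th i <= pi.
Proof. by rewrite thS addrAC subrr add0r ang_ge0 ?ang_lepi. Qed.

Let thD i n : th (i + n)%N - th i = \sum_(l < n) ang (x (i + l)%N) (x (i + l).+1).
Proof.
elim: n => [|n IH]; first by rewrite addn0 subrr big_ord0.
by rewrite big_ord_recr/= -IH addnS thS; ring.
Qed.

(* Both ways around the apex join the spokes [i] and [i + n]; the spherical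
   triangle inequality holds for the shorter one. *)
Let cos_th_le i n : (n <= N)%N ->
  cos (th (i + n)%N - th i) <= cos (ang (x i) (x (i + n)%N)).
Proof.
move=> nN.
have pi0 := @pi_gt0 R.
have h1 : ang (x i) (x (i + n)%N) <= th (i + n)%N - th i.
  by rewrite thD; exact: ang_sum.
have h2 : ang (x i) (x (i + n)%N) <= 2 * pi - (th (i + n)%N - th i).
  have -> : 2 * pi - (th (i + n)%N - th i) = th (i + n + (N - n))%N - th (i + n)%N.
    by rewrite -addnA subnKC// th_per; ring.
  have E : (i + N = i + n + (N - n))%N by lia.
  rewrite angC -[x i]x_per E thD.
  exact: ang_sum.
have a0 := ang_ge0 (x0 i) (x0 (i + n)%N).
have api := ang_lepi (x0 i) (x0 (i + n)%N).
set a := ang _ _ in h1 h2 a0 api *; set D := th _ - th _ in h1 h2 *.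
have [Dpi|Dpi] := leP D pi.
  rewrite leNgt ltr_cos ?in_itv/= ?a0 ?api ?Dpi ?(le_trans a0 h1)// -leNgt//.
have -> : cos D = cos (2 * pi - D).
  by rewrite -cosN -(cosD2pi (- D)); congr cos; ring.
by rewrite leNgt ltr_cos ?in_itv/= ?a0 ?api ?(le_trans a0 h2)/= -?leNgt//; lra.
Qed.

(** Lowering an index by a period [N] changes [th] by a full turn and leaves [x] fixed, so index
    differences up to [N] suffice. *)
Let cos_th_le_all i m : cos (th i - th m) <= cos (ang (x i) (x m)).
Proof.
wlog mi : i m / (m <= i)%N.
  move=> H; have [h|h] := leqP m i; first exact: H.
  by rewrite -cosN opprB angC H// ltnW.
rewrite angC; elim: i {-2}i (leqnn i) mi => [|k IH] i ik mi.
  have -> : i = m by lia.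
  by have := @cos_th_le m 0%N (leq0n N); rewrite addn0.
have [h|h] := leqP (i - m) N.
  by have := cos_th_le m h; rewrite subnKC.
have N_gt0 : (0 < N)%N.
  rewrite lt0n; apply/eqP => N0; move: angle2pi; rewrite /cone_angle N0 big_ord0.
  by have := @pi_gt0 R; lra.
have -> : i = ((i - N) + N)%N by lia.
rewrite th_per x_per.
have -> : th (i - N)%N + 2 * pi - th m = th (i - N)%N - th m + pi *+ 2 by ring.
by rewrite cosD2pi; apply: IH; lia.
Qed.

(** Vertex [w i] has the distance to the apex as radius and the accumulated angle [th i] as polar
    angle. By the law of cosines, edge lengths are kept, and [cos_th_le_all] shows that distances
    between points of spokes do not decrease. *)
Lemma planar_development : exists w : nat -> 'rV[R]_2, [/\
  forall i, w (i + N)%N = w i,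
  forall i, edist (w i.+1) (w i) = edist (v i.+1) (v i),
  forall i m s t, 0 <= s -> 0 <= t ->
    edist (p + s *: (v i - p)) (p + t *: (v m - p)) <= edist (s *: w i) (t *: w m) &
  forall m s b, 0 <= s <= 1 -> exists i j l t,
    [/\ 0 <= l <= 1, 0 <= t, [\/ j = i, j = i.+1 | i = j.+1] &
      (1 - l) *: w i + l *: w j = s *: w m + t *: polar 1 b]].
Proof.
pose w i := polar (r i) (th i).
have w_per i : w (i + N)%N = w i.
  rewrite /w th_per /r x_per.
  by apply: row2P; rewrite ?polar0 ?polar1 mulr_natl ?cosD2pi ?sinD2pi.
have rr i m : dotp (x i) (x m) = r i * r m * cos (ang (x i) (x m)).
  exact: dotp_cos_ang.
exists w; split=> //.
- move=> i; rewrite !edistE -(subr_sub3 (v i.+1) (v i) p) -/(x i) -/(x i.+1).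
  rewrite /vnorm; congr Num.sqrt.
  rewrite (dotpBB (w i.+1)) (dotpBB (x i.+1)) !dotp_polar !subrr cos0 -!sqr_vnorm -/(r i) -/(r i.+1) !mulr1.
  by rewrite rr angC thS [th i + _ - _]addrAC subrr add0r; ring.
- move=> i m s t s0 t0.
  rewrite -ler_sqr ?nnegrE ?edist_ge0// !sqr_edist.
  rewrite opprD addrACA subrr add0r -/(x i) -/(x m).
  rewrite (dotpBB (_ *: w i)) (dotpBB (_ *: x i)) !dotpZl !dotpZr.
  rewrite !dotp_polar !subrr cos0 -!sqr_vnorm -/(r i) -/(r m) !mulr1 rr.
  have : s * t * (r i * r m) * cos (th i - th m) <=
         s * t * (r i * r m) * cos (ang (x i) (x m)).
    by rewrite ler_wpM2l// !mulr_ge0// ltW.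
  by rewrite !expr2; lra.
move=> m s b s01.
(* Spoke [m + N] equals spoke [m] and has a full turn of spokes before it, so indices can also run
   backwards. *)
have [b' [/andP[b1 b2] cb sb]] := angle_representative b (th (m + N)%N).
have fin i j l t :
    (1 - l) * (r i * cos (th i)) + l * (r j * cos (th j)) =
      s * (r (m + N)%N * cos (th (m + N)%N)) + t * cos b' ->
    (1 - l) * (r i * sin (th i)) + l * (r j * sin (th j)) =
      s * (r (m + N)%N * sin (th (m + N)%N)) + t * sin b' ->
    (1 - l) *: w i + l *: w j = s *: w m + t *: polar 1 b.
  rewrite cb sb => h1 h2; rewrite -(w_per m) /w !polarZ.
  apply: row2P; rewrite [LHS]mxE [RHS]mxE ?polar0 ?polar1; lra.
have [h|h] := leP (th (m + N)%N) b'.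
  have [|||||i [l [t [l01 t0 e1 e2]]]] :=
      @ray_crossing R (fun i => r (m + N + i)%N) (fun i => th (m + N + i)%N) _ _ s b'.
  - by move=> i; exact: r_gt0.
  - by move=> i; rewrite addnS; exact: th_incr.
  - exact: s01.
  - by rewrite addn0 h.
  - by exists N; rewrite th_per; have := @pi_gt0 R; lra.
  exists (m + N + i)%N, (m + N + i).+1, l, t; split=> //; first by constructor 2.
  by apply: fin; rewrite -addnS; rewrite addn0 in e1 e2.
(* Clockwise case: indices reversed and angles negated. Truncated subtraction freezes the index at
   0, which is the origin of the alternative [j = i]. *)
have [|||||i [l [t [l01 t0 e1 e2]]]] :=
    @ray_crossing R (fun i => r (m + N - i)%N) (fun i => - th (m + N - i)%N) _ _ s (- b').
- by move=> i; exact: r_gt0.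
- move=> i; rewrite opprK.
  have [hi|hi] := ltnP i (m + N)%N.
    by rewrite addrC -(subnSK hi); exact: th_incr.
  have -> : (m + N - i.+1 = 0)%N by lia.
  have -> : (m + N - i = 0)%N by lia.
  by rewrite addrC subrr lexx pi_ge0.
- exact: s01.
- by rewrite subn0; apply/andP; split; lra.
- exists N; rewrite addnK; have := th_per m; lra.
exists (m + N - i)%N, (m + N - i.+1)%N, l, t; split=> //.
  have [hi|hi] := ltnP i (m + N)%N; first by constructor 3; lia.
  by constructor 1; lia.
apply: fin.
  by move: e1; rewrite subn0 !cosN.
by move: e2; rewrite subn0 !sinN; lra.
Qed.

End PlanarDevelopment.

(** * Lengths of closed planar polygons *)

Section DiscreteCrofton.
Variable R : realType.

Lemma sum_cyclic_shift (F : nat -> R) h : F h = F 0%N ->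
  \sum_(k < h) F k.+1 = \sum_(k < h) F k.
Proof.
case: h => [|h] Fh; first by rewrite !big_ord0.
by rewrite big_ord_recr [in RHS]big_ord_recl/= Fh addrC.
Qed.

(* With step [pi / h], all terms become nonnegative after shifting the starting
   angle to [-pi / 2]; the sum then telescopes. *)
Lemma sum_abs_cos_le (h : nat) (phi : R) : (0 < h)%N ->
  \sum_(k < h) `|cos (phi + k%:R * (pi / h%:R))| <= (sin (pi / h%:R / 2))^-1.
Proof.
move=> h0; set a := pi / h%:R.
have hR : 0 < h%:R :> R by rewrite ltr0n.
have pi0 := @pi_gt0 R.
have a0 : 0 < a by rewrite divr_gt0.
have ha : h%:R * a = pi by rewrite /a mulrC divfK// gt_eqF.
have a_le : a <= pi by rewrite /a ler_pdivrMr// ler_peMr ?ler1n// ltW.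
have sa : 0 < sin (a / 2) by apply: sin_gt0_pi; apply/andP; split; lra.
pose S x := \sum_(k < h) `|cos (x + k%:R * a)|.
have S_shift x : S (x + a) = S x.
  rewrite /S -(sum_cyclic_shift (F := fun k => `|cos (x + k%:R * a)|)).
    by apply: eq_bigr => k _; rewrite -natr1 mulrDl mul1r [_ + a in RHS]addrC addrA.
  by rewrite ha cosDpi normrN mul0r addr0.
have S_shiftn n x : S (x + n%:R * a) = S x.
  elim: n x => [|n IH] x; first by rewrite mul0r addr0.
  by rewrite -natr1 mulrDl mul1r addrA S_shift IH.
pose n := Num.floor ((phi + pi / 2) / a).
have hn : n%:~R * a <= phi + pi / 2 < (n%:~R + 1) * a.
  rewrite -ler_pdivlMr// -ltr_pdivrMr// -[1]/(1%:~R) -intrD.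
  by rewrite floor_le_tmp floorD1_gt.
pose y := phi - n%:~R * a.
have -> : \sum_(k < h) `|cos (phi + k%:R * a)| = S y.
  rewrite -/(S phi) /y; case: (n) => j; last first.
    by rewrite NegzE mulrNz mulNr opprK S_shiftn.
  by rewrite -[X in S X](subrK (j%:R * a)) S_shiftn.
have [y1 y2] : - (pi / 2) <= y /\ y < - (pi / 2) + a.
  by case/andP: hn => h1 h2; rewrite /y; split; lra.
have cos_ge (k : nat) : (k < h)%N -> 0 <= cos (y + k%:R * a).
  move=> kh; apply: cos_ge0_pihalf.
  have : k%:R * a + a <= h%:R * a.
    by rewrite -[X in _ + X]mul1r -mulrDl ler_pM2r// natr1 ler_nat.
  have : 0 <= k%:R * a by rewrite mulr_ge0// ltW.
  by rewrite ha => h1 h2; apply/andP; split; lra.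
rewrite /S; under eq_bigr => k _ do rewrite ger0_norm ?cos_ge//.
rewrite -(ler_pM2l (mulr_gt0 (ltr0n R 2) sa)).
have -> : 2 * sin (a / 2) * (sin (a / 2))^-1 = 2 by field; rewrite gt_eqF.
rewrite mulr_sumr -(big_mkord xpredT (fun k => 2 * sin (a / 2) * cos (y + k%:R * a))).
rewrite (telescope_sumr_eq (fun k => sin (y - a / 2 + k%:R * a)))//; last first.
  move=> k _; set z := y + k%:R * a.
  have -> : y - a / 2 + k.+1%:R * a = z + a / 2 by rewrite /z -[k.+1%:R]natr1; field.
  have -> : y - a / 2 + k%:R * a = z - a / 2 by rewrite /z; lra.
  by rewrite sinD sinB; ring.
rewrite ha sinDpi mul0r addr0.
by have := sin_geN1 (y - a / 2); lra.
Qed.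

Lemma polygon_step_le (q : nat) : (0 < q)%N -> pi / (q + q)%:R <= pi / 2 :> R.
Proof.
move=> q0; rewrite ler_wpM2l ?pi_ge0// lef_pV2 ?posrE ?ltr0n ?addn_gt0 ?q0//.
by rewrite ler_nat (leq_add q0 q0).
Qed.

Lemma polarP (e : 'rV[R]_2) : exists phi, e = polar (vnorm e) phi.
Proof.
have [->|e0] := eqVneq e 0.
  exists 0; rewrite vnorm0; apply: row2P; rewrite ?polar0 ?polar1 mxE mul0r//.
have n0 : 0 < vnorm e by rewrite vnorm_gt0.
pose x := e ord0 0 / vnorm e.
have x1 : -1 <= x <= 1.
  by rewrite -ler_norml normrM normfV (gtr0_norm n0) ler_pdivrMr// mul1r coord_le_vnorm.
have cx : cos (acos x) = x by rewrite acosK// in_itv.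
have nE : vnorm e ^+ 2 = e ord0 0 ^+ 2 + e ord0 1 ^+ 2.
  by rewrite sqr_vnorm dotp2 !expr2.
have sx : vnorm e * sin (acos x) = `|e ord0 1|.
  have E : 1 - x ^+ 2 = (e ord0 1 / vnorm e) ^+ 2.
    rewrite /x !expr_div_n; apply: (mulIf (lt0r_neq0 (exprn_gt0 2 n0))).
    rewrite mulrBl !divfK ?expf_neq0 ?gt_eqF// nE; ring.
  rewrite sin_acos// E sqrtr_sqr normrM normfV (gtr0_norm n0).
  by rewrite mulrC divfK// gt_eqF.
have xe : vnorm e * x = e ord0 0 by rewrite /x mulrC divfK// gt_eqF.
have [h|h] := leP 0 (e ord0 1).
  by exists (acos x); apply: row2P; rewrite ?polar0 ?polar1 ?cx ?sx ?xe// ger0_norm.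
exists (- acos x); apply: row2P; rewrite ?polar0 ?polar1 ?cosN ?sinN ?cx ?xe//.
by rewrite mulrN sx ltr0_norm// opprK.
Qed.

Definition direction (h k : nat) : 'rV[R]_2 := polar 1 (k%:R * (pi / h%:R)).

Lemma direction_half h k : (0 < h)%N -> direction h (k + h) = - direction h k.
Proof.
move=> h0; rewrite /direction natrD mulrDl.
have -> : h%:R * (pi / h%:R) = pi :> R by rewrite mulrC divfK// pnatr_eq0 -lt0n.
by apply: row2P; rewrite [RHS]mxE ?polar0 ?polar1 ?cosDpi ?sinDpi mulrN.
Qed.

Lemma sum_width_le (h : nat) (e : 'rV[R]_2) : (0 < h)%N ->
  \sum_(k < h) `|dotp e (direction h k)| <= vnorm e / sin (pi / h%:R / 2).
Proof.
move=> h0; have [phi eE] := polarP e.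
rewrite [in X in X <= _]eE.
under eq_bigr => k _ do rewrite dotp_polar mulr1 normrM ger0_norm ?vnorm_ge0//
  -cosN opprB addrC.
rewrite -mulr_sumr; apply: ler_wpM2l; first exact: vnorm_ge0.
exact: sum_abs_cos_le.
Qed.

Lemma ler_norm_telescope (c : nat -> R) m n : (m <= n)%N ->
  `|c n - c m| <= \sum_(m <= i < n) `|c i.+1 - c i|.
Proof. by move=> mn; rewrite -telescope_sumr//; exact: ler_norm_sum. Qed.

(** A closed walk covers the interval between two of its values at least twice, once in each
    direction. *)
Lemma closed_walk_width (c : nat -> R) N a b : c N = c 0%N ->
  (a <= N)%N -> (b <= N)%N ->
  2 * (c a - c b) <= \sum_(i < N) `|c i.+1 - c i|.
Proof.
move=> cN aN bN.
rewrite -(big_mkord xpredT (fun i => `|c i.+1 - c i|)).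
have key x y : (x <= y)%N -> (y <= N)%N ->
    2 * `|c y - c x| <= \sum_(0 <= i < N) `|c i.+1 - c i|.
  move=> xy yN.
  rewrite (big_cat_nat (leq0n x) (leq_trans xy yN))/=.
  rewrite (big_cat_nat xy yN)/=.
  have := ler_norm_telescope c (leq0n x); have := ler_norm_telescope c xy.
  have := ler_norm_telescope c yN; rewrite cN.
  have := ler_normD (c x - c 0%N) (c 0%N - c y); rewrite subrKA distrC.
  by lra.
have [h|h] := leqP a b.
  by apply: le_trans (key _ _ h bN); rewrite distrC ler_pM2l// ler_norm.
by apply: le_trans (key _ _ (ltnW h) aN); rewrite ler_pM2l// ler_norm.
Qed.

(** Opposite directions are paired: [H k + H (k + h)] is at most the width of the polygon in
    direction [k], whose double is at most the total projection of the edges. Summing over [k] and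
    exchanging the sums, [sum_width_le] bounds the projections of each edge by its length. *)
Lemma closed_polygon_length_ge (w : nat -> 'rV[R]_2) (N h : nat) (H : nat -> R) :
  (0 < h)%N -> w N = w 0%N ->
  (forall k, exists2 i, (i <= N)%N & H k <= dotp (w i) (direction h k)) ->
  2 * sin (pi / h%:R / 2) * \sum_(k < h + h) H k <=
  \sum_(i < N) edist (w i.+1) (w i).
Proof.
move=> h0 wN wH.
have hR : 0 < h%:R :> R by rewrite ltr0n.
have pi0 := @pi_gt0 R.
have sa : 0 < sin (pi / h%:R / 2) :> R.
  apply: sin_gt0_pi; apply/andP; split; first by rewrite !divr_gt0.
  have : pi / h%:R <= pi :> R by rewrite ler_pdivrMr// ler_peMr ?ler1n// ltW.
  by lra.
rewrite mulrAC -ler_pdivlMr// mulr_suml.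
have step (i : 'I_N) : \sum_(k < h) `|dotp (w i.+1 - w i) (direction h k)| <=
    edist (w i.+1) (w i) / sin (pi / h%:R / 2).
  by rewrite edistE sum_width_le.
apply: le_trans (ler_sum _ (fun i _ => step i)).
rewrite exchange_big/= big_split_ord/= -big_split/= mulr_sumr.
apply: ler_sum => k _.
have [i iN Hi] := wH k; have [j jN Hj] := wH (h + k)%N.
have := @closed_walk_width (fun i => dotp (w i) (direction h k)) N i j.
rewrite wN => /(_ erefl iN jN).
have -> : \sum_(l < N) `|dotp (w l.+1 - w l) (direction h k)| =
    \sum_(l < N) `|dotp (w l.+1) (direction h k) - dotp (w l) (direction h k)|.
  by apply: eq_bigr => l _; rewrite dotpDl dotpNl.
move: Hj; rewrite addnC direction_half// dotpNr.
by lra.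
Qed.

End DiscreteCrofton.

(** * Parametrised closed polygons *)

Section PolygonCurve.
Variables (R : realType) (d : nat) (x : nat -> 'rV[R]_d) (M : nat).
Hypotheses (M_gt0 : (0 < M)%N) (xM : x M = x 0%N).

Let clamp (y : R) : R := Num.max 0 (Num.min 1 y).

Let clamp_le0 y : y <= 0 -> clamp y = 0.
Proof. by move=> y0; apply/max_idPl; rewrite ge_min y0 orbT. Qed.

Let clamp_ge1 y : 1 <= y -> clamp y = 1.
Proof. by move=> y1; rewrite /clamp (min_idPl y1); apply/max_idPr; exact: ler01. Qed.

Let clamp_id y : 0 <= y <= 1 -> clamp y = y.
Proof. by move=> /andP[y0 y1]; rewrite /clamp (min_idPr y1); apply/max_idPr. Qed.

Let clamp_mono y z : y <= z -> clamp y <= clamp z.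
Proof. by move=> yz; rewrite /clamp ge_max le_max lexx/= le_max le_min !ge_min lexx yz !orbT. Qed.

Let cont_clamp : continuous clamp.
Proof.
apply: cont_max; first exact: cont_cst.
by apply: cont_min; [exact: cont_cst|exact: cont_id].
Qed.

(** Edge [k] is added progressively while [t] runs from [k / M] to [(k + 1) / M]; as a sum of
    clamped terms the path is continuous without any gluing at vertices. *)
Let arc (t : R) : 'rV[R]_d :=
  x 0%N + \sum_(k < M) clamp (M%:R * t - k%:R) *: (x k.+1 - x k).

Let F (t : R) : R := \sum_(k < M) clamp (M%:R * t - k%:R) * edist (x k.+1) (x k).

Let arc_cont : continuous arc.
Proof.
apply: continuous_rV => i.
have -> : (fun t => arc t ord0 i) = (fun t => x 0%N ord0 i +
    \sum_(k < M) clamp (M%:R * t - k%:R) * (x k.+1 - x k) ord0 i).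
  apply: funext => t; rewrite mxE summxE; congr (_ + _).
  by apply: eq_bigr => k _; rewrite mxE.
apply: contD; first exact: cont_cst.
apply: continuous_sumr => k; apply: contM; last exact: cont_cst.
apply: (cont_comp _ cont_clamp); apply: contB; last exact: cont_cst.
by apply: contM; [exact: cont_cst|exact: cont_id].
Qed.

Let MR : 0 < M%:R :> R. Proof. by rewrite ltr0n. Qed.

Let arc_le0 t : t <= 0 -> arc t = x 0%N.
Proof.
move=> t0; rewrite /arc big1 ?addr0// => k _.
rewrite clamp_le0 ?scale0r// subr_le0 (@le_trans _ _ 0)//.
by rewrite pmulr_rle0.
Qed.

Let clamp_last t (k : 'I_M) : 1 <= t -> clamp (M%:R * t - k%:R) = 1.
Proof.
move=> t1; apply: clamp_ge1; rewrite lerBrDr addrC natr1.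
apply: (@le_trans _ _ M%:R); first by rewrite ler_nat.
by rewrite ler_peMr// ltW.
Qed.

Let arc_ge1 t : 1 <= t -> arc t = x 0%N.
Proof.
move=> t1; rewrite /arc; under eq_bigr do rewrite clamp_last// scale1r.
rewrite -(big_mkord xpredT (fun k => x k.+1 - x k)) telescope_sumr//.
by rewrite xM subrr addr0.
Qed.

Definition polygon_curve (t : R) : 'rV[R]_d := arc (t - (Num.floor t)%:~R).

Let polygon_curveE t : 0 <= t <= 1 -> polygon_curve t = arc t.
Proof.
move=> /andP[t0 t1]; rewrite /polygon_curve.
have [t_lt1|t_ge1] := ltP t 1.
  by rewrite (@floor_def _ t 0) ?subr0// t0/= add0r.
have -> : t = 1 by apply/eqP; rewrite eq_le t1.
by rewrite floor1 subrr arc_le0// arc_ge1.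
Qed.

Lemma polygon_curve_closed : closed_curve polygon_curve.
Proof.
split=> [t0|t]; last first.
  rewrite /polygon_curve.
  have -> : Num.floor (t + 1) = Num.floor t + 1.
    apply: floor_def; rewrite !intrD; have := floor_itv t.
    by rewrite intrD => /andP[h1 h2]; apply/andP; split; lra.
  by congr arc; rewrite intrD; ring.
pose m := Num.floor t0.
have /andP[m1 m2] : m%:~R <= t0 < m%:~R + 1.
  by have := floor_itv t0; rewrite intrD.
pose G (t : R) := arc (t - m%:~R) + (arc (t - m%:~R + 1) - x 0%N).
have PG t : m%:~R - 1 < t < m%:~R + 1 -> polygon_curve t = G t.
  move=> /andP[t1 t2]; rewrite /polygon_curve /G.
  have [h|h] := leP m%:~R t.
    rewrite (@floor_def _ t m) ?intrD ?h//.
    by rewrite (@arc_ge1 (t - m%:~R + 1)) ?subrr ?addr0//; lra.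
  rewrite (@floor_def _ t (m - 1)); last first.
    by rewrite subrK intrB h andbT; lra.
  rewrite (@arc_le0 (t - m%:~R)); last lra.
  have -> : t - (m - 1)%:~R = t - m%:~R + 1 by rewrite intrB; ring.
  by rewrite [RHS]addrC subrK.
have cG : continuous G.
  have c (s : R) : continuous (fun t : R => arc (t - m%:~R + s)).
    apply: (cont_comp _ arc_cont); apply: contD; last exact: cont_cst.
    by apply: contB; [exact: cont_id|exact: cont_cst].
  apply: contD; last by apply: contB; [exact: c|exact: cont_cst].
  by move: (c 0); under eq_fun do rewrite addr0.
have near_eq : \forall t \near t0, G t = polygon_curve t.
  near=> t; rewrite PG//; apply/andP; split; near: t.
    by apply: lt_nbhsr; lra.
  by apply: lt_nbhsl; lra.
rewrite /continuous_at PG; last by apply/andP; split; lra.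
apply: cvg_trans (cG t0); exact: near_eq_cvg.
Unshelve. all: by end_near. Qed.

Let arc_lip s t : s <= t -> edist (arc t) (arc s) <= F t - F s.
Proof.
move=> st; rewrite edistE /arc opprD addrACA subrr add0r -sumrB /F -sumrB.
apply: le_trans (vnorm_sum _ _ _) _; apply: ler_sum => k _.
rewrite -scalerBl -mulrBl vnormZ -edistE ger0_norm// subr_ge0.
by apply: clamp_mono; rewrite lerD2r ler_pM2l.
Qed.

Lemma polygon_curve_length :
  (curve_length polygon_curve <= (\sum_(k < M) edist (x k.+1) (x k))%:E)%E.
Proof.
apply: ge_ereal_sup => _ [k [t [t0 tk tm ->]]]; rewrite lee_fin.
have mono i j : (i <= j <= k)%N -> t i <= t j.
  elim: j => [|j IH]; first by rewrite leqn0 => /andP[/eqP->].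
  rewrite leq_eqVlt => /andP[/orP[/eqP->//|ij] jk].
  by apply: le_trans (tm _ jk); apply: IH; rewrite -ltnS ij ltnW.
have t01 i : (i <= k)%N -> 0 <= t i <= 1.
  by move=> ik; rewrite -{1}t0 -tk !mono ?leqnn ?ik//.
have step (i : 'I_k) : edist (polygon_curve (t i.+1)) (polygon_curve (t i)) <=
    F (t i.+1) - F (t i).
  by rewrite !polygon_curveE ?t01 ?arc_lip ?tm// ltnW.
apply: le_trans (ler_sum _ (fun i _ => step i)) _.
rewrite -(big_mkord xpredT (fun i => F (t i.+1) - F (t i))).
rewrite (telescope_sumr_eq (fun i => F (t i)))// t0 tk /F -sumrB.
apply: ler_sum => i _; rewrite clamp_last// mul1r gerBl mulr_ge0 ?edist_ge0//.
by rewrite le_max lexx.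
Qed.

Lemma polygon_curve_edge k l : (k < M)%N -> 0 <= l <= 1 ->
  range polygon_curve ((1 - l) *: x k + l *: x k.+1).
Proof.
move=> kM /andP[l0 l1]; pose t := (k%:R + l) / M%:R.
have kR : k%:R + 1 <= M%:R :> R by rewrite natr1 ler_nat.
have t01 : 0 <= t <= 1.
  by rewrite divr_ge0 ?addr_ge0//= ler_pdivrMr// mul1r; lra.
exists t => //; rewrite polygon_curveE// /arc.
have Mt : M%:R * t = k%:R + l by rewrite /t mulrC divfK// gt_eqF.
rewrite Mt -(big_mkord xpredT (fun i => clamp (k%:R + l - i%:R) *: (x i.+1 - x i))).
rewrite (big_cat_nat (leq0n k) (ltnW kM))/= (big_ltn kM).
have -> : \sum_(0 <= i < k) clamp (k%:R + l - i%:R) *: (x i.+1 - x i) = x k - x 0%N.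
  rewrite -telescope_sumr//; apply: eq_big_nat => i /andP[_ ik].
  rewrite clamp_ge1 ?scale1r//.
  by have : i%:R + 1 <= k%:R :> R; [rewrite natr1 ler_nat|lra].
have -> : \sum_(k.+1 <= i < M) clamp (k%:R + l - i%:R) *: (x i.+1 - x i) = 0.
  rewrite big_nat big1// => i /andP[ki _]; rewrite clamp_le0 ?scale0r//.
  by have : k%:R + 1 <= i%:R :> R; [rewrite natr1 ler_nat|lra].
rewrite addr0 addrA [x 0%N + _]addrC subrK.
rewrite clamp_id; last by apply/andP; split; lra.
by apply/rowP => i; rewrite !mxE; ring.
Qed.

End PolygonCurve.

(** * The polygon circumscribed about the unit disks *)

Section CircumscribedPolygon.
Variables (R : realType) (n q : nat) (c : 'I_n -> 'rV[R]_2) (H : nat -> R).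
Hypotheses (q_gt0 : (0 < q)%N)
  (c_sep : forall i j, i != j -> 2 < edist (c i) (c j)).

Let h := (q + q)%N.
Let M := (h + h)%N.
Let a : R := pi / h%:R.
Let u k := direction R h k.

Hypotheses (H_ge : forall k j, dotp (c j) (u k) + 1 <= H k)
  (H_att : forall k, exists j, H k = dotp (c j) (u k) + 1).

Let h_gt0 : (0 < h)%N. Proof. by rewrite addn_gt0 q_gt0. Qed.
Let hR : 0 < h%:R :> R. Proof. by rewrite ltr0n. Qed.
Let a_gt0 : 0 < a. Proof. by rewrite divr_gt0 ?pi_gt0. Qed.
Let ha : h%:R * a = pi. Proof. by rewrite mulrC divfK// gt_eqF. Qed.
Let a_lt : a <= pi / 2. Proof. exact: polygon_step_le. Qed.
Let s_gt0 : 0 < sin a.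
Proof. by apply: sin_gt0_pi; rewrite a_gt0; have := a_lt; have := @pi_gt0 R; lra. Qed.

Let u_per k : u (k + M)%N = u k.
Proof. by rewrite /u addnA !direction_half// opprK. Qed.

Let H_per k : H (k + M)%N = H k.
Proof.
apply/eqP; rewrite eq_le; apply/andP; split.
  by have [j ->] := H_att (k + M)%N; rewrite u_per H_ge.
by have [j ->] := H_att k; rewrite -u_per H_ge.
Qed.

Let uE k : u k = polar 1 (k%:R * a). Proof. by []. Qed.

Let v k : 'rV[R]_2 := polar 1 (k%:R * a + pi / 2).

Let uu k : dotp (u k) (u k) = 1.
Proof. by rewrite dotp_polar subrr cos0; ring. Qed.
Let vv k : dotp (v k) (v k) = 1.
Proof. by rewrite dotp_polar subrr cos0; ring. Qed.
Let uu1 k : dotp (u k) (u k.+1) = cos a.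
Proof.
rewrite dotp_polar -[k.+1%:R]natr1 -cosN !mul1r; congr cos; rewrite -/a; ring.
Qed.
Let vu1 k : dotp (v k) (u k.+1) = sin a.
Proof.
rewrite dotp_polar -[k.+1%:R]natr1 !mul1r -/a.
have -> : k%:R * a + pi / 2 - (k%:R + 1) * a = - a + pi / 2 by ring.
by rewrite cosDpihalf sinN opprK.
Qed.
Let uv1 k : dotp (u k) (v k.+1) = - sin a.
Proof.
rewrite dotp_polar -[k.+1%:R]natr1 !mul1r -/a -cosN.
have -> : - (k%:R * a - ((k%:R + 1) * a + pi / 2)) = a + pi / 2 by ring.
by rewrite cosDpihalf.
Qed.
Let vv1 k : dotp (v k) (v k.+1) = cos a.
Proof.
rewrite dotp_polar -[k.+1%:R]natr1 !mul1r -/a -cosN.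
by congr cos; ring.
Qed.

Let decomp k (z : 'rV[R]_2) : z = dotp z (u k) *: u k + dotp z (v k) *: v k.
Proof.
have cs := cos2Dsin2 (k%:R * a).
rewrite !dotp2 !polar0 !polar1 cosDpihalf sinDpihalf !mul1r -/a.
set C := cos _; set S := sin _.
have e0 (y : R) : y = y * (C ^+ 2 + S ^+ 2) by rewrite cs mulr1.
have E (A B : R) i : (A *: u k + B *: v k) ord0 i = A * u k ord0 i + B * v k ord0 i.
  by rewrite mxE [X in X + _]mxE [X in _ + X]mxE.
apply: row2P; rewrite E ?polar0 ?polar1 ?cosDpihalf ?sinDpihalf !mul1r -/a -/C -/S.
  by rewrite [LHS]e0; ring.
by rewrite [LHS]e0; ring.
Qed.

(** Intersection of the supporting lines with normals [u k] and [u k.+1]; [v k] is [u k] turned by a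
    right angle. *)
Let x k : 'rV[R]_2 := H k *: u k + ((H k.+1 - H k * cos a) / sin a) *: v k.

Let s_neq0 : sin a != 0. Proof. by rewrite gt_eqF. Qed.
Let cs : cos a ^+ 2 + sin a ^+ 2 = 1. Proof. exact: cos2Dsin2. Qed.

Let xE k : x k = H k.+1 *: u k.+1 + ((H k.+1 * cos a - H k) / sin a) *: v k.+1.
Proof.
rewrite [LHS](decomp k.+1) /x !dotpDl !dotpZl uu1 vu1 uv1 vv1; congr (_ *: _ + _ *: _).
  by rewrite divfK//; ring.
apply/eqP; rewrite -subr_eq0.
set lhs := (X in X == _).
have -> : lhs = H k * (1 - (cos a ^+ 2 + sin a ^+ 2)) / sin a by rewrite /lhs; field.
by rewrite cs subrr mulr0 mul0r.
Qed.

Let l k := (H k.+2 + H k - 2 * cos a * H k.+1) / sin a.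

(** Test the disk that attains [H k.+1] in the two neighbouring directions: they sum to [2 cos a]
    times [u k.+1], and its radius contributes [2], which is at least [2 cos a]. *)
Let l_ge0 k : 0 <= l k.
Proof.
apply: divr_ge0; last exact: ltW.
have [j E] := H_att k.+1.
have := H_ge k j; have := H_ge k.+2 j; rewrite E.
have -> : u k = cos a *: u k.+1 - sin a *: v k.+1.
  by rewrite {1}(decomp k.+1 (u k)) uu1 uv1 scaleNr.
have -> : u k.+2 = cos a *: u k.+1 + sin a *: v k.+1.
  by rewrite (decomp k.+1 (u k.+2)) ![dotp (u k.+2) _]dotpC uu1 vu1.
rewrite dotpDr dotpDr dotpNr !dotpZr.
by have := cos_le1 a; lra.
Qed.

Let edge k : x k.+1 - x k = l k *: v k.+1.
Proof.
rewrite (xE k) {1}/x opprD addrACA subrr add0r -scalerBl; congr (_ *: _).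
by rewrite /l -mulrBl; congr (_ / _); ring.
Qed.

Let x_per k : x (k + M)%N = x k.
Proof.
have v_per : v (k + M)%N = v k.
  apply: row2P; rewrite ?polar0 ?polar1 ?cosDpihalf ?sinDpihalf.
    by have := congr1 (fun z : 'rV[R]_2 => z ord0 1) (u_per k);
      rewrite !polar1 -/a !mul1r => ->.
  by have := congr1 (fun z : 'rV[R]_2 => z ord0 0) (u_per k);
    rewrite !polar0 -/a !mul1r => ->.
by rewrite /x -addSn !H_per u_per v_per.
Qed.

Let M_gt0 : (0 < M)%N. Proof. by rewrite addn_gt0 h_gt0. Qed.

Let xM : x M = x 0%N. Proof. by rewrite -(x_per 0) add0n. Qed.

Let g := polygon_curve x M.

Let perimeter : \sum_(k < M) edist (x k.+1) (x k) =
  (2 - 2 * cos a) / sin a * \sum_(k < M) H k.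
Proof.
have -> : \sum_(k < M) edist (x k.+1) (x k) = \sum_(k < M) l k.
  apply: eq_bigr => k _.
  by rewrite edistE edge vnormZ /vnorm vv sqrtr1 mulr1 ger0_norm.
have S1 : \sum_(k < M) H k.+1 = \sum_(k < M) H k.
  by apply: sum_cyclic_shift; rewrite -(H_per 0) add0n.
have S2 : \sum_(k < M) H k.+2 = \sum_(k < M) H k.
  rewrite -S1; apply: (sum_cyclic_shift (F := fun k => H k.+1)).
  by rewrite -(H_per 1) add1n.
rewrite /l -mulr_suml sumrB big_split/= -mulr_sumr S1 S2.
by field.
Qed.

Let inside k z := dotp z (u k) <= H k.

Let boundary k z : (forall i, inside i z) -> dotp z (u k.+1) = H k.+1 ->
  exists2 t, 0 <= t <= 1 & z = (1 - t) *: x k + t *: x k.+1.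
Proof.
move=> zin zk; set y := dotp z (v k.+1).
have zE : z = H k.+1 *: u k.+1 + y *: v k.+1 by rewrite {1}(decomp k.+1 z) zk.
(* The constraints of index [k.+2] and [k] confine the tangential coordinate of [z] between the two
   ends of the edge. *)
have y_le : y <= (H k.+2 - H k.+1 * cos a) / sin a.
  rewrite ler_pdivlMr//; have := zin k.+2.
  by rewrite /inside zE dotpDl !dotpZl uu1 vu1; lra.
have y_ge : (H k.+1 * cos a - H k) / sin a <= y.
  rewrite ler_pdivrMr//; have := zin k.
  rewrite /inside zE dotpDl !dotpZl [dotp (u k.+1) _]dotpC uu1.
  by rewrite [dotp (v k.+1) _]dotpC uv1; lra.
have lE : l k = (H k.+2 - H k.+1 * cos a) / sin a - (H k.+1 * cos a - H k) / sin a.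
  by rewrite /l -mulrBl; congr (_ / _); ring.
have x1 : x k.+1 = x k + l k *: v k.+1 by rewrite -edge addrC subrK.
have [l0|l0] := eqVneq (l k) 0.
  exists 0; rewrite ?lexx ?ler01// subr0 scale1r scale0r addr0 xE zE.
  by congr (_ + _ *: _); lra.
have l_gt0 : 0 < l k by rewrite lt_neqAle eq_sym l0 l_ge0.
exists ((y - (H k.+1 * cos a - H k) / sin a) / l k).
  rewrite divr_ge0 ?subr_ge0//= ler_pdivrMr// mul1r lE; lra.
set t := _ / l k.
have -> : (1 - t) *: x k + t *: x k.+1 = x k + (t * l k) *: v k.+1.
  by rewrite x1; apply/rowP => i; rewrite !mxE; ring.
rewrite /t divfK// xE zE -addrA -scalerDl; congr (_ + _ *: _); ring.
Qed.

Let boundary_range z : (forall i, inside i z) ->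
  (exists2 k, (k < M)%N & dotp z (u k) = H k) -> range g z.
Proof.
move=> zin [k kM zk].
have [k' k'M zk'] : exists2 k', (k' < M)%N & dotp z (u k'.+1) = H k'.+1.
  case: k kM zk => [|k] kM zk; last by exists k => //; exact: ltnW.
  exists M.-1; rewrite prednK//.
  by have := u_per 0; have := H_per 0; rewrite !add0n => -> ->.
have [t t01 ->] := boundary zin zk'.
exact: polygon_curve_edge.
Qed.

Let polygon_surrounds j : surrounds_disk g (c j).
Proof.
move=> p pc gp.
have pin k : inside k p.
  apply: le_trans (H_ge k j).
  rewrite -lerBlDl -dotpNl -dotpDl; apply: le_trans (cauchy_schwarz _ _) _.
  by rewrite [vnorm (u k)]/vnorm uu sqrtr1 mulr1 -edistE.
(* The directions [0], [q], [h] and [q + h] are the four coordinate half-axes; this is why [h] is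
   taken even. *)
exists (2 * (`|H 0%N| + `|H q| + `|H h| + `|H (q + h)%N|)).
move=> z [C [Cp Cg Cconn] Cz].
have cdot k : continuous (fun y : 'rV[R]_2 => dotp y (u k)).
  by apply: continuous_dotp; [exact: cont_id|exact: cont_cst].
pose U := [set y : 'rV[R]_2 | forall k : 'I_M, dotp y (u k) < H k].
pose V := [set y : 'rV[R]_2 | forall k : 'I_M, dotp y (u k) <= H k].
have inV y : V y -> forall k, inside k y.
  move=> Vy k; rewrite /inside.
  have E (i : nat) : u (k %% M)%N = u k /\ H (k %% M)%N = H k.
    rewrite [in u k](divn_eq k M) [in H k](divn_eq k M).
    elim: (k %/ M)%N => [//|m IH].
    by rewrite mulSn -addnA addnC u_per H_per.
  have [<- <-] := E 0%N.
  by have := Vy (Ordinal (ltn_pmod k M_gt0)).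
(* [C] avoids the curve, so the open and the closed polygon have the same trace on it. This trace is
   open and closed in [C], hence all of [C]. *)
have CV : C `&` U = C `&` V.
  apply/seteqP; split=> y [Cy yk]; split=> // k; first exact: ltW.
  rewrite lt_neqAle yk andbT; apply/eqP => E.
  by apply: (Cg _ Cy); apply: boundary_range; [exact: inV|exists k].
have CU : C `&` U = C.
  apply: Cconn.
  - exists p; split=> // k; have pk : dotp p (u k) <= H k := pin k.
    rewrite lt_neqAle pk andbT; apply/eqP => E.
    by apply: gp; apply: boundary_range => //; exists k.
  - exists U => //; rewrite openE => y Uy.
    have : \forall z \near y, forall k : 'I_M, dotp z (u k) < H k.
      apply: (@filter_forall _ 'I_M (fun k => [set z | dotp z (u k) < H k]) (nbhs y)).
      by move=> k; exact: (cdot k y _ (lt_nbhsl (Uy k))).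
    by [].
  - exists V; last by [].
    have -> : V = \bigcap_(k in [set: 'I_M]) [set y | dotp y (u k) <= H k].
      by apply/seteqP; split=> y yV k => [_|]; exact: yV.
    apply: closed_bigI => k _.
    exact: (@preimage_closed _ _ (fun y : 'rV[R]_2 => dotp y (u k)) _
      (in1W (cdot k)) (@closed_le _ (H k))).
have Vz : V z.
  have [_ Uz] : (C `&` U) z by rewrite CU.
  by move=> k; exact: ltW.
have qa : q%:R * a = pi / 2.
  have : 2 * (q%:R * a) = pi by rewrite -ha /h natrD; ring.
  by lra.
have u0E : u 0%N = polar 1 0 by rewrite uE mul0r.
have uqE : u q = polar 1 (pi / 2) by rewrite uE qa.
have b1 := inV _ Vz 0%N; have b2 := inV _ Vz q.
have b3 := inV _ Vz h; have b4 := inV _ Vz (q + h)%N.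
move: b1 b2 b3 b4; rewrite /inside.
rewrite -[u h]/(u (0 + h)%N) /u !direction_half// -!/(u _) !dotpNr u0E uqE !dotp2.
rewrite !polar0 !polar1 cos0 sin0 cos_pihalf sin_pihalf !mulr0 !mulr1 addr0 add0r.
move=> b1 b2 b3 b4.
rewrite edistE subr0; apply: le_trans (vnorm_le_sum _) _.
rewrite !big_ord_recl big_ord0 addr0.
have -> : lift ord0 ord0 = 1 :> 'I_2 by exact: val_inj.
have := ler_norm (H 0%N); have := ler_norm (H q).
have := ler_norm (H h); have := ler_norm (H (q + h)%N).
have n1 (y A B : R) : y <= A -> - y <= B -> `|y| <= `|A| + `|B|.
  move=> yA yB; have := ler_norm A; have := ler_norm B.
  have := normr_ge0 A; have := normr_ge0 B.
  by rewrite ler_norml => *; apply/andP; split; lra.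
have := n1 _ _ _ b1 b3; have := n1 _ _ _ b2 b4.
have := normr_ge0 (H 0%N); have := normr_ge0 (H q).
have := normr_ge0 (H h); have := normr_ge0 (H (q + h)%N).
by lra.
Qed.

Lemma Pn_le_circumscribed :
  (Pn R n <= ((2 - 2 * cos a) / sin a * \sum_(k < M) H k)%:E)%E.
Proof.
rewrite -perimeter; apply: le_trans (polygon_curve_length M_gt0 xM).
apply: ereal_inf_lbound; exists g; split=> //.
  exact: polygon_curve_closed.
by exists c; split=> //; exact: polygon_surrounds.
Qed.

End CircumscribedPolygon.

(** * Inscribed polygons of a closed curve *)

Section CurveApproximation.
Variable R : realType.

Lemma closed_curve_uniform d (g : R -> 'rV[R]_d) (del : R) :
  closed_curve g -> 0 < del ->
  exists e, 0 < e /\ forall s t, `|s - t| < e -> edist (g s) (g t) < del.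
Proof.
move=> cg del0.
(* Pairs whose images are [del] apart form a compact set off the diagonal. Parameters less than 1
   apart can be shifted by one integer into [[0, 2]], not always into [[0, 1]]. *)
pose A : set (R * R) := (`[0, 2]%classic `*` `[0, 2]%classic) `&`
  (fun q : R * R => edist (g q.1) (g q.2)) @^-1` [set y | del <= y].
have cd : continuous (fun q : R * R => edist (g q.1) (g q.2)).
  apply: continuous_edist; apply: (cont_comp _ cg.1) => q; [exact: cvg_fst|exact: cvg_snd].
have cA : compact A.
  apply: compact_closedI; first by apply: compact_setX; exact: segment_compact.
  exact: (@preimage_closed _ _ _ _ (in1W cd) (@closed_ge _ del)).
have cn : continuous (fun q : R * R => `|q.1 - q.2|).
  by apply: cont_norm; apply: contB => q; [exact: cvg_fst|exact: cvg_snd].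
have nA q : A q -> 0 < `|q.1 - q.2|.
  move=> [_ /= h]; rewrite normr_gt0 subr_eq0; apply/eqP => E.
  by move: h; rewrite E edist_xx; lra.
have [e0 e0_gt0 e0P] := compact_lower_bound cA cn nA.
exists (Num.min e0 1); rewrite lt_min e0_gt0 ltr01; split=> // s t.
rewrite lt_min => /andP[st0 st1].
wlog st : s t st0 st1 / s <= t.
  move=> H; have [h|h] := leP s t; first exact: H.
  by rewrite edistC; apply: H; rewrite 1?distrC// ltW.
rewrite ltNge; apply/negP => h.
rewrite distrC ger0_norm ?subr_ge0// in st1.
have := frac_itv s; rewrite in_itv/= => /andP[f0 f1].
have := e0P (s - (Num.floor s)%:~R, t - (Num.floor s)%:~R).
have -> : (s - (Num.floor s)%:~R, t - (Num.floor s)%:~R).1 -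
    (s - (Num.floor s)%:~R, t - (Num.floor s)%:~R).2 = s - t by rewrite /=; ring.
rewrite [e0 <= _]leNgt st0 => H; suff : false by [].
apply: H; split; last by rewrite /= -!mulrNz !closed_curve_int.
by split; rewrite /= in_itv/=; apply/andP; split; lra.
Qed.

Lemma curve_length_ge_polygon d (g : R -> 'rV[R]_d) (N : nat) : (0 < N)%N ->
  ((\sum_(i < N) edist (g (i.+1%:R / N%:R)) (g (i%:R / N%:R)))%:E <= curve_length g)%E.
Proof.
move=> N0; have NR : 0 < N%:R :> R by rewrite ltr0n.
apply: ereal_sup_ubound; exists N, (fun i => i%:R / N%:R); split=> //.
- by rewrite mul0r.
- by rewrite divff// gt_eqF.
- by move=> i _; rewrite ler_pM2r ?invr_gt0// ler_nat.
Qed.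

Lemma sin_ge_xcosx (x : R) : 0 <= x <= pi -> x * cos x <= sin x.
Proof.
move=> /andP[x0 xpi].
have [|c] := @MVT_segment R sin cos 0 x x0.
- by apply: continuous_subspaceT => y; exact: continuous_sin.
rewrite in_itv/= sin0 !subr0 => /andP[c0 cx] ->.
rewrite mulrC ler_wpM2r//.
have [->//|ne] := eqVneq c x.
have c_lt : c < x by rewrite lt_neqAle ne.
by apply: ltW; rewrite ltr_cos// in_itv/=; apply/andP; split; lra.
Qed.

End CurveApproximation.

(** * The length bound *)

Section RopeLength.
Variable R : realType.

Lemma thickness_thick_set (L S : set 'rV[R]_3) :
  thickness L = 1%E -> S `<=` L -> thick_set S.
Proof.
move=> thL SL x y z Sx Sy Sz xy yz xz.
by apply: (thickness_triple thL); try exact: SL; apply/eqP.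
Qed.

Lemma compact_sublink (m n : nat) (g : 'I_m -> R -> 'rV[R]_3) (k : 'I_m)
    (f : 'I_m -> 'I_n) (j : 'I_n) :
  is_link g -> compact (sublink g k f j).
Proof.
move=> [sg _].
have -> : sublink g k f j =
    \big[setU/set0]_(i <- enum 'I_m | (i != k) && (f i == j)) range (g i).
  rewrite -bigcup_seq_cond; apply: eq_bigcupl; split=> i /=.
    by case=> ik fij; rewrite mem_enum ik fij eqxx.
  by move=> /and3P[_ ik /eqP fij].
by apply: bigsetU_compact => i _; exact: compact_closed_curve (sg i).1.
Qed.

Lemma half_angle_ratio (a : R) : 0 < a <= pi / 2 ->
  (2 - 2 * cos a) / sin a = 2 * sin (a / 2) / cos (a / 2).
Proof.
move=> /andP[a0 a1]; have pi0 := @pi_gt0 R.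
have s0 : 0 < sin (a / 2) by apply: sin_gt0_pi; apply/andP; split; lra.
have c0 : 0 < cos (a / 2) by apply: cos_gt0_pihalf; apply/andP; split; lra.
have -> : cos a = cos (a / 2) ^+ 2 *+ 2 - 1 by rewrite -cos_mulr2n; congr cos; lra.
have -> : sin a = (cos (a / 2) * sin (a / 2)) *+ 2.
  by rewrite -sin_mulr2n; congr sin; lra.
have e := cos2Dsin2 (a / 2).
have -> : 2 - 2 * (cos (a / 2) ^+ 2 *+ 2 - 1) = 4 * sin (a / 2) ^+ 2 by lra.
by field; rewrite !gt_eqF.
Qed.

(** Scaling by [2 / rho] turns [H k + rho] into [(2 / rho * H k + 1) + 1]. The first part is the
    support value of the unit disks, up to the ratio [cos (a / 2)] of sine to tangent; the remaining
    1, summed over all directions, gives [2 * pi * cos (a / 2)] by [x cos x <= sin x]. *)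
Lemma perimeter_comparison (q : nat) (rho len : R) (H : nat -> R) :
  let a := pi / (q + q)%:R in (0 < q)%N -> 0 < rho ->
  2 * sin (a / 2) * \sum_(k < q + q + (q + q)) (H k + rho) <= len ->
  cos (a / 2) * ((2 - 2 * cos a) / sin a *
    \sum_(k < q + q + (q + q)) (2 / rho * H k + 1) + 2 * pi) <= 2 / rho * len.
Proof.
move=> a q0 rho0.
have a_le : a <= pi / 2 := polygon_step_le R q0.
have pi0 := @pi_gt0 R.
have hR : 0 < (q + q)%:R :> R by rewrite ltr0n addn_gt0 q0.
have a0 : 0 < a by rewrite divr_gt0.
have ha : (q + q)%:R * a = pi by rewrite mulrC divfK// gt_eqF.
have c0 : 0 < cos (a / 2) by apply: cos_gt0_pihalf; apply/andP; split; lra.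
have sinc : a / 2 * cos (a / 2) <= sin (a / 2).
  by apply: sin_ge_xcosx; apply/andP; split; lra.
have lam0 : 0 < 2 / rho by rewrite divr_gt0.
have lamrho : 2 / rho * rho = 2 by rewrite divfK// gt_eqF.
rewrite half_angle_ratio ?a0// !big_split/= -mulr_sumr !sumr_const card_ord.
move: lam0 lamrho ha hR sinc c0; rewrite mulrnDr -[rho *+ _]mulr_natr.
rewrite [(q + q + (q + q))%:R]natrD.
set h := (q + q)%:R; set l := 2 / rho; set s := sin _; set c := cos _.
set S := \sum_(k < _) H k.
move=> lam0 lamrho ha hR sinc c0 /(ler_wpM2l (ltW lam0)); apply: le_trans.
have -> : l * (2 * s * (S + (rho * h + rho * h))) =
    2 * s * (l * S + 2 * (l * rho) * h) by ring.
have -> : c * (2 * s / c * (l * S + (h + h)) + 2 * pi) =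
    2 * s * (l * S + (h + h)) + 2 * (c * pi) by field; rewrite gt_eqF.
rewrite lamrho.
have : h * (a / 2 * c) <= h * s by rewrite ler_pM2l.
have -> : h * (a / 2 * c) = c * (h * a) / 2 by ring.
by rewrite ha; lra.
Qed.

(* The points of the sublinks on the cone over [K] become, in the development of
   the cone, centers of disks of radius [rho < 2] inside the convex hull [W] of
   the developed curve. In each direction the support function of [W] exceeds
   that of the centers by [rho]; half of this excess is used by the unit disks
   of [Pn], the other half accounts for [2 * pi]. *)
Lemma ropelength_approx (n q : nat) (K : R -> 'rV[R]_3) (z : 'I_n -> set 'rV[R]_3) (rho : R) :
  (0 < n)%N -> (0 < q)%N -> 0 < rho < 2 -> simple_closed_curve K ->
  (forall j x t, z j x -> 2 <= edist (K t) x) ->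
  (forall i j x y, i != j -> z i x -> z j y -> 2 <= edist x y) ->
  (forall j p, exists s t, [/\ 0 <= s <= 1, 0 <= t < 1 & z j (p + s *: (K t - p))]) ->
  exists X len, [/\ (Pn R n <= X%:E)%E, (len%:E <= curve_length K)%E &
    cos (pi / (q + q)%:R / 2) * (X + 2 * pi) <= 2 / rho * len].
Proof.
move=> n0 q0 /andP[rho0 rho2] sK zK zz zcone.
have cK := sK.1.
have pi0 := @pi_gt0 R.
(* At most [2 * del] is lost from a distance 2, and [2 - 2 * del > rho]. *)
pose del := (2 - rho) / 4.
have del0 : 0 < del by rewrite /del; lra.
have [r [r0 rP]] := closed_curve_uniform cK del0.
pose N := (Num.truncn r^-1).+2.
have NR : 0 < N%:R :> R by rewrite ltr0n.
have N1 : (1 < N)%N by [].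
have Nr : N%:R^-1 < r.
  rewrite invf_plt ?posrE//; apply: lt_le_trans (truncnS_gt _) _.
  by rewrite ler_nat leqW.
have {}N_gt0 : (0 < N)%N by [].
clearbody N.
pose v (i : nat) := K (i%:R / N%:R).
have vN i : v (i + N)%N = v i.
  by rewrite /v natrD mulrDl divff ?gt_eqF// cK.2.
have v_edge i : edist (v i.+1) (v i) <= del.
  apply/ltW/rP; rewrite -mulrBl -natr1 addrAC subrr add0r mul1r.
  by rewrite gtr0_norm// invr_gt0.
have v01 : v 0%N != v 1%N.
  apply: simple_closed_curve_neq => //; first by rewrite mul0r mul1r invr_gt0.
  by rewrite mul0r add0r mul1r invf_lt1// ltr1n.
have [p [vp angp]] := cone_apex_exists vN N1 v01.
have [w [w_per w_edge w_dist w_ray]] := planar_development vN vp angp.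
have [s /choice[t stP]] := choice (fun j => zcone j p).
pose x j := p + s j *: (K (t j) - p).
have xz j : z j (x j) by have [] := stP j.
have s01 j : 0 <= s j <= 1 by have [] := stP j.
pose m j := Num.truncn (t j * N%:R).
have Km j : edist (K (t j)) (v (m j)) <= del.
  have [_ /andP[t0 _] _] := stP j.
  apply/ltW/rP.
  have /andP[h1 h2] := truncn_itv (mulr_ge0 t0 (ltW NR)).
  have -> : t j - (m j)%:R / N%:R = (t j * N%:R - (m j)%:R) / N%:R.
    by field; rewrite gt_eqF.
  rewrite normrM normfV (gtr0_norm NR) ger0_norm ?subr_ge0//.
  apply: lt_trans Nr; rewrite ltr_pdivrMr// mulVf ?gt_eqF//.
  by move: h2; rewrite -natr1 /m; lra.
(* The development compares distances only on spokes, so [x j] is replaced by the point at the same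
   ratio on the spoke of the preceding vertex. *)
pose y j := p + s j *: (v (m j) - p).
have xy j : edist (x j) (y j) <= del.
  rewrite edistE opprD addrACA subrr add0r -scalerBr subr_sub3 vnormZ -edistE.
  have /andP[h1 h2] := s01 j; rewrite ger0_norm//; apply: le_trans (Km j).
  by rewrite ler_piMl ?edist_ge0.
pose c j := s j *: w (m j).
have c_sep i j : i != j -> rho < edist (c i) (c j).
  move=> ij; have /andP[si _] := s01 i; have /andP[sj _] := s01 j.
  apply: lt_le_trans (w_dist (m i) (m j) _ _ si sj).
  have := zz _ _ _ _ ij (xz i) (xz j).
  have := edist_triangle (x i) (y i) (x j); have := edist_triangle (y i) (y j) (x j).
  have := xy i; have := xy j; rewrite [edist (y j) (x j)]edistC -/(y i) -/(y j) /del.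
  by lra.
have w_far i j : rho + del < edist (w i) (c j).
  have /andP[sj _] := s01 j.
  have := w_dist i (m j) _ _ ler01 sj.
  rewrite !scale1r [p + (_ - p)]addrC subrK -/(y j) -/(c j) => h.
  apply: lt_le_trans h.
  have := zK j _ (i%:R / N%:R) (xz j); rewrite -/(v i).
  have := edist_triangle (v i) (y j) (x j).
  have := xy j; rewrite [edist (y j) (x j)]edistC /del.
  by lra.
pose h := (q + q)%N.
have h0 : (0 < h)%N by rewrite addn_gt0 q0.
pose u k := direction R h k.
have uu k : dotp (u k) (u k) = 1 by rewrite dotp_polar subrr cos0; ring.
have w_mod i : w i = w (i %% N)%N.
  rewrite {1}(divn_eq i N); elim: (i %/ N)%N => [//|d IH].
  by rewrite mulSn -addnA addnC w_per.
(* The ray from [c j] in direction [u k] leaves through an edge, at distance [T > rho] because that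
   edge is short and its vertices are far from [c j]. The crossing point is a convex combination of
   the ends, so one end reaches as far in direction [u k]. *)
have support k j : exists2 i, (i <= N)%N & dotp (c j) (u k) + rho <= dotp (w i) (u k).
  suff [i Hi] : exists i, dotp (c j) (u k) + rho <= dotp (w i) (u k).
    by exists (i %% N)%N; [rewrite ltnW// ltn_mod|rewrite -w_mod].
  have [i [i' [l [T [/andP[l0 l1] T0 adj E]]]]] := w_ray (m j) _ (k%:R * (pi / h%:R)) (s01 j).
  rewrite -/(u k) -/(c j) in E.
  have edge : edist (w i') (w i) <= del.
    case: adj => ->; first by rewrite edist_xx ltW.
      by rewrite w_edge.
    by rewrite edistC w_edge.
  have TE : rho < T.
    have -> : T = vnorm (T *: u k) by rewrite vnormZ /vnorm uu sqrtr1 mulr1 ger0_norm.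
    have -> : T *: u k = (w i - c j) - l *: (w i - w i').
      have -> : T *: u k = (1 - l) *: w i + l *: w i' - c j.
        by rewrite E [c j + _]addrC addrK.
      by apply/rowP => a; rewrite !mxE; ring.
    have := vnormD (w i - c j - l *: (w i - w i')) (l *: (w i - w i')).
    rewrite subrK -edistE vnormZ ger0_norm// -edistE [edist (w i) (w i')]edistC.
    have : l * edist (w i') (w i) <= del.
      by apply: le_trans edge; rewrite ler_piMl ?edist_ge0.
    by have := w_far i j; lra.
  have {}E := congr1 (fun a => dotp a (u k)) E.
  rewrite !dotpDl !dotpZl uu mulr1 -[s j * _]dotpZl -/(c j) in E.
  have [hi|hi] := leP (dotp (c j) (u k) + rho) (dotp (w i) (u k)); first by exists i.
  exists i'; rewrite leNgt; apply/negP => hi'.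
  have h1 : (1 - l) * dotp (w i) (u k) <= (1 - l) * (dotp (c j) (u k) + rho).
    by rewrite ler_wpM2l ?subr_ge0// ltW.
  have h2 : l * dotp (w i') (u k) <= l * (dotp (c j) (u k) + rho).
    by rewrite ler_wpM2l// ltW.
  by move: E; lra.
have jmax k : exists j, forall j', dotp (c j') (u k) <= dotp (c j) (u k).
  have [j _ jP] := @arg_maxP _ _ _ (Ordinal n0) xpredT (fun j => dotp (c j) (u k)) isT.
  by exists j => j'; exact: jP.
have [J JP] := choice jmax.
pose hQ k := dotp (c (J k)) (u k).
pose lam := 2 / rho.
have lam0 : 0 < lam by rewrite divr_gt0.
have lamrho : lam * rho = 2 by rewrite divfK// gt_eqF.
have wN : w N = w 0%N by rewrite -(w_per 0) add0n.
have := @closed_polygon_length_ge R w N h (fun k => hQ k + rho) h0 wN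
  (fun k => support k (J k)).
set len := \sum_(i < N) _ => lenP.
have := @Pn_le_circumscribed R n q (fun j => lam *: c j) (fun k => lam * hQ k + 1) q0.
set X := _ / _ * _ => XP.
exists X, len; split.
- apply: XP.
  + move=> i j ij; rewrite edistE -scalerBr vnormZ gtr0_norm// -edistE -lamrho.
    by rewrite ltr_pM2l// c_sep.
  + by move=> k j; rewrite dotpZl lerD2r ler_pM2l.
  + by move=> k; exists (J k); rewrite dotpZl.
- rewrite /len; under eq_bigr do rewrite w_edge.
  exact: curve_length_ge_polygon.
exact: perimeter_comparison lenP.
Qed.

Lemma cos_small (mu : R) : mu < 1 ->
  exists2 q, (0 < q)%N & mu <= cos (pi / (q + q)%:R / 2).
Proof.
move=> mu1; have d0 : 0 < 1 - mu by rewrite subr_gt0.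
have /cvgrPdist_lt/(_ _ d0) := @continuous_cos R 0.
rewrite cos0 => /nbhs_ballP[e /= e0 eP].
have pi0 := @pi_gt0 R.
pose q := (Num.truncn (pi / e)).+1.
have q0 : 0 < q%:R :> R by rewrite ltr0n.
exists q => //; set y := pi / _ / 2.
have y0 : 0 < y by rewrite !divr_gt0// ltr0n addn_gt0.
have qe : pi < q%:R * e.
  by rewrite -ltr_pdivrMr//; exact: truncnS_gt.
have ye : y < e.
  rewrite /y natrD ltr_pdivrMr// ltr_pdivrMr ?addr_gt0//.
  have : 0 < q%:R * e by rewrite mulr_gt0.
  by lra.
have /eP/= : ball 0 e y by rewrite -ball_normE/= sub0r normrN gtr0_norm.
by have := ler_norm (1 - cos y); lra.
Qed.

End RopeLength.

Theorem theorem2 (R : realType) (m n : nat) (g : 'I_m -> R -> 'rV[R]_3)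
    (k : 'I_m) (f : 'I_m -> 'I_n) :
  is_link g ->
  thickness (link_set g) = 1%E ->
  (forall j : 'I_n, topologically_linked (sublink g k f j) (range (g k))) ->
  ((2 * pi)%:E + Pn R n <= curve_length (g k))%E.
Proof.
move=> link thL linked.
(* [f] is total, so even its value at [k] provides an element of ['I_n]. *)
have n0 : (0 < n)%N := leq_ltn_trans (leq0n _) (ltn_ord (f k)).
have pi0 := @pi_gt0 R.
have [sg disj] := link.
have gL i : range (g i) `<=` link_set g by move=> x gx; exists i.
have subL j : sublink g k f j `<=` link_set g by move=> x [i _ gx]; exists i.
have dist2 i i' x y : i != i' -> range (g i) x -> range (g i') y -> 2 <= edist x y.
  move=> ii' gx gy.
  apply: (component_dist_ge2 thL (gL i) (gL i') (sg i) (sg i').1) => // z gz gz'.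
  by have /disj_set2P/seteqP[+ _] := disj _ _ ii' => /(_ z); apply.
have approx q rho : (0 < q)%N -> 0 < rho < 2 -> exists X len,
    [/\ (Pn R n <= X%:E)%E, (len%:E <= curve_length (g k))%E &
      cos (pi / (q + q)%:R / 2) * (X + 2 * pi) <= 2 / rho * len].
  move=> q0 hr; apply: (ropelength_approx n0 q0 hr (sg k) (z := sublink g k f)).
  - by move=> j x t [i [ik _] gx]; apply: (dist2 k i) => //; rewrite eq_sym.
  - move=> j j' x y jj' [i [_ fi] gx] [i' [_ fi'] gy]; apply: (dist2 i i') => //.
    by apply: contra_neq jj' => ii'; rewrite -fi -fi' ii'.
  - move=> j p; apply: linked_meets_cone => //; last exact: (sg k).1.
      exact: compact_sublink.
    exact: thickness_thick_set thL (subL j).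
case LE : (curve_length (g k)) => [L| |]; last 2 first.
- by rewrite leey.
- by have := curve_length_ge_polygon (g k) (ltn0Sn 0); rewrite LE leeNy_eq.
have L0 : 0 <= L.
  rewrite -lee_fin -LE; apply: le_trans (curve_length_ge_polygon (g k) (ltn0Sn 0)).
  by rewrite lee_fin; apply: sumr_ge0 => i _; exact: edist_ge0.
apply/lee_addgt0Pr => e e0; rewrite -EFinD.
(* The choices of [rho] and [q] cost a factor [1 + x] each, and [(1 + x)^2 * L <= L + 3 * x * L]
   because [x <= 1/3]. *)
pose x := Num.min (e / (L + 1)) 1 / 3.
have L1 : 0 < L + 1 by rewrite ltr_wpDl.
have x0 : 0 < x by rewrite divr_gt0// lt_min ltr01 divr_gt0.
have xL : 3 * x * (L + 1) <= e.
  by rewrite -ler_pdivlMr// mulrC divfK// ge_min lexx.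
have x1 : 3 * x <= 1 by rewrite mulrC divfK// ge_min lexx orbT.
pose mu := (1 + x)^-1.
have mu0 : 0 < mu by rewrite invr_gt0 addr_gt0.
have mu1 : mu < 1 by rewrite invf_lt1 ?addr_gt0// ltrDl.
have [q q0 cq] := cos_small mu1.
have [|X [len [PX lenL XL]]] := approx q (2 * mu) q0; first by apply/andP; split; lra.
rewrite LE lee_fin in lenL.
apply: le_trans (leeD2l _ PX) _; rewrite -EFinD lee_fin.
have [neg|pos] := leP (X + 2 * pi) 0; first by lra.
have mux : mu * (1 + x) = 1 by rewrite mulVf// gt_eqF// addr_gt0.
have h1 : mu * (X + 2 * pi) <= (1 + x) * L.
  apply: le_trans (_ : (1 + x) * len <= _); last by rewrite ler_pM2l// addr_gt0.
  have -> : (1 + x) * len = 2 / (2 * mu) * len.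
    by rewrite /mu; field; rewrite gt_eqF// addr_gt0.
  by apply: le_trans XL; rewrite ler_pM2r.
have h2 : X + 2 * pi <= (1 + x) * ((1 + x) * L).
  have -> : X + 2 * pi = (1 + x) * (mu * (X + 2 * pi)).
    by rewrite mulrA [(1 + x) * _]mulrC mux mul1r.
  by rewrite ler_pM2l// addr_gt0.
have h3 : x * (x * L) <= x * (1 * L).
  by rewrite ler_pM2l// ler_wpM2r//; lra.
by lra.
Qed.
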